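(* A set $B$ of monomial symmetric polynomials in the Jucys–Murphy elements, $B\subseteq\{m_\mu(L_1,\dots,L_4):\mu\text{ a partition}\}$, is a $\mathbb Z$-basis of the centre $Z(\mathbb Z S_4)$ if and only if $B$ is one of the following: $\{m_{\emptyset}, m_1, m_2, m_{1,1}, m_{1,1,1}\}$; $\{m_{\emptyset}, m_1, m_{1,1}, m_{1,1,1}, m_{2,2,2}\}$; $\{m_1, m_2, m_{1,1}, m_{1,1,1}, m_{2,2}\}$; $\{m_1, m_{1,1}, m_{1,1,1}, m_{2,2}, m_{2,2,2}\}$; $\{m_{\emptyset}, m_1, m_2, m_{1,1}, m_{3}\}$; $\{m_{\emptyset}, m_1, m_{1,1}, m_{2,2,2}, m_{3}\}$; $\{m_1, m_2, m_{1,1}, m_{3}, m_{2,2}\}$; $\{m_1, m_{1,1}, m_{3}, m_{2,2}, m_{2,2,2}\}$; $\{m_{\emptyset}, m_1, m_{1,1}, m_{1,1,1}, m_{i,i,2}\}$ for some odd $i\ge1$; $\{m_{\emptyset}, m_1, m_{1,1}, m_{3}, m_{i,i,2}\}$ for some odd $i\ge1$.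
   Context: $S_4$ is the symmetric group on $\{1,2,3,4\}$, $\mathbb Z S_4$ its integral group ring, and $Z(\mathbb Z S_4)$ its centre (a free $\mathbb Z$-module of rank 5 with basis the conjugacy class sums). The Jucys–Murphy elements are $L_1=0$ and $L_i=\sum_{k=1}^{i-1}(k\ i)$ for $i=2,3,4$; they pairwise commute, and symmetric polynomials in them are central. For a partition $\mu=(\mu_1,\dots,\mu_r)$, $m_\mu(x_1,\dots,x_4)$ is the monomial symmetric polynomial: the sum of all distinct monomials $x_1^{\alpha_1}\cdots x_4^{\alpha_4}$ with $(\alpha_1,\dots,\alpha_4)$ a rearrangement of $(\mu_1,\dots,\mu_r,0,\dots,0)$ ($m_\mu=0$ if $r>4$; $m_\emptyset=1$). We write $m_\mu$ for $m_\mu(L_1,\dots,L_4)$, omit parentheses in subscripts, and $m_{i,i,2}$ denotes $m_\mu$ with $\mu$ the partition whose parts are $i,i,2$ sorted decreasingly. *)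

(* Defs.v *)
From HB Require Import structures.
From mathcomp Require Import all_boot all_order all_fingroup all_algebra.
Set Implicit Arguments. Unset Strict Implicit. Unset Printing Implicit Defensive.
Import GRing.Theory.
Local Open Scope ring_scope.

(* The integral group ring Z S_4: functions 'S_4 -> int (finitely supported
   trivially, S_4 being finite). Points 1..4 of the paper are 0..3 here. *)
Notation ZS4 := {ffun 'S_4 -> int}.

Definition gdelta (g : 'S_4) : ZS4 := [ffun h => ((h == g) : nat)%:Z].

Definition gmul (a b : ZS4) : ZS4 :=
  [ffun g => \sum_(h : 'S_4) a h * b ((h^-1)%g * g)%g].

Definition gone : ZS4 := gdelta 1%g.

Definition gexp (a : ZS4) (n : nat) : ZS4 := iter n (gmul a) gone.

(* Jucys–Murphy element L_{i+1} = sum_{k < i} (k i); L_1 = 0 *)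
Definition JM (i : 'I_4) : ZS4 :=
  \sum_(k < 4 | (k < i)%N) gdelta (tperm k i).

Definition JMmono (a : seq nat) : ZS4 :=
  foldr (fun i acc => gmul (gexp (JM i) (nth 0%N a i)) acc) gone (enum 'I_4).

Definition is_partition (mu : seq nat) : bool :=
  sorted geq mu && all (fun x => (0 < x)%N) mu.

(* monomial symmetric polynomial m_mu evaluated at (L_1,..,L_4):
   sum over the distinct rearrangements of (mu, 0, ..., 0); zero if mu has
   more than 4 parts.  [permutations] is duplicate-free. *)
Definition m_mu (mu : seq nat) : ZS4 :=
  if (size mu <= 4)%N then
    \sum_(a <- permutations (mu ++ nseq (4 - size mu) 0%N)) JMmono a
  else 0.

Definition central (z : ZS4) : Prop := forall x : ZS4, gmul z x = gmul x z.

Definition is_Zbasis_of_centre (B : ZS4 -> Prop) : Prop :=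
  (forall (s : seq ZS4) (c : ZS4 -> int),
      uniq s -> (forall b, b \in s -> B b) ->
      \sum_(b <- s) b *~ c b = 0 -> forall b, b \in s -> c b = 0)
  /\ (forall z : ZS4, central z <->
        exists (s : seq ZS4) (c : ZS4 -> int),
          (forall b, b \in s -> B b) /\ z = \sum_(b <- s) b *~ c b).

Definition mu_ii2 (i : nat) : seq nat := sort geq [:: i; i; 2%N].

(* Main.v *)
(* Since L_1 = 0, only partitions with at most three parts matter, and m_mu acts on the Specht
   module of lambda by the scalar m_mu(contents of lambda). Conjugating lambda multiplies this
   scalar by (-1)^|mu|, so m_mu lies either in the even part of the centre (spanned by the
   classes of 1, (123), (12)(34)) or in the odd part (spanned by the classes of (12), (1234)).
   A basis therefore consists of three even and two odd elements, each with coordinate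
   determinant +-1. Modulo 2, a nonzero even m_mu is (1,0,0), (0,1,1) or (0,1,0), according to
   mu = (k,k) with k even, (l,l) with l odd, or (i,i,2); all three kinds must occur. A nonzero odd
   m_mu has mu = (1), or mu = (k) or (i,j) with k > 1 odd and i + j odd, or mu = (i,i,1).
   The determinants of the remaining combinations are exponential expressions in the exponents,
   and growth estimates and congruences leave only the listed solutions. *)
Require Import Defs.
From HB Require Import structures.
From mathcomp Require Import all_boot all_order all_fingroup all_algebra.
From mathcomp Require Import ring lra zify.
Set Implicit Arguments. Unset Strict Implicit. Unset Printing Implicit Defensive.
Import Order.TTheory GRing.Theory Num.Theory.
Local Open Scope ring_scope.

(** The exponents are unbounded, so no product of Jucys-Murphy elements is ever expanded in the
    group ring. Instead, 48 times the identity is written as a combination of ten common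
    eigenvectors, one per standard tableau; this is a finite computation, and every monomial then
    acts through powers of contents. Passing from class coordinates to scalars multiplies
    determinants by -48 on the even side and by -24 on the odd side, so each determinant condition
    becomes an exponential equation with a fixed constant. Two of these have genuine small solutions
    (exponents 2 and 1 for [exp_even], 3 and 0 for [exp_odd]), so a modulus under which all powers
    are purely periodic cannot exclude the larger exponents: they repeat the solution. Modulus 27
    breaks the repetition because powers of 3 vanish there from exponent 3 on. Modulus 19 goes with
    it because 2 and 3 have order 18 modulo 19, and 2 has order 18 modulo 27. *)

Local Notation expz := (fun (x : int) n => x ^+ n).

(** * One-line notation and the group ring *)

Definition code (g : 'S_4) : seq nat := [seq val (g j) | j <- enum 'I_4].

Definition codes : seq (seq nat) := permutations (iota 0 4).

Lemma map_enum_ord n (T : Type) (f : nat -> T) :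
  [seq f (val j) | j <- enum 'I_n] = [seq f j | j <- iota 0 n].
Proof. by rewrite (map_comp f val) val_enum_ord. Qed.

Lemma nth_code g (j : 'I_4) : nth 0%N (code g) j = g j.
Proof. by rewrite (nth_map j) ?size_enum_ord // nth_ord_enum. Qed.

Lemma code_inj : injective code.
Proof.
by move=> g h e; apply/permP => j; apply: val_inj; rewrite /= -!nth_code e.
Qed.

Lemma code_in g : code g \in codes.
Proof.
rewrite mem_permutations; apply: uniq_perm.
- by rewrite map_inj_uniq ?enum_uniq // => i j /val_inj /perm_inj.
- exact: iota_uniq.
move=> x; rewrite mem_iota /=; apply/mapP/idP => [[j _ ->]|lt_x]; first exact: ltn_ord.
by exists (g^-1%g (Ordinal lt_x)); rewrite ?mem_enum // permKV.
Qed.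

(** Counting: [code] is injective, and the 24 permutations fill a list of length 24. *)
Lemma codesP u : u \in codes -> exists g, code g = u.
Proof.
have := code_in; set s := map code (enum 'S_4) => Hin.
have us : uniq s by rewrite map_inj_uniq ?enum_uniq //; exact: code_inj.
have sub : {subset s <= codes} by move=> _ /mapP [g _ ->].
have [] := uniq_min_size us sub.
  by rewrite size_map -cardE card_Sn size_permutations ?iota_uniq.
move=> _ e; rewrite -e => /mapP [g _ ->]; by exists g.
Qed.

Definition compc (u v : seq nat) := [seq nth 0%N v j | j <- u].

Lemma code_mul g h : code (g * h)%g = compc (code g) (code h).
Proof.
rewrite /compc /code -map_comp; apply: eq_map => j /=.
by rewrite permM -nth_code.
Qed.

Definition tpn (k i j : nat) : nat :=
  if j == k then i else if j == i then k else j.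

(* Products of permutations act on the right, so left multiplication by the transposition
   (k i) exchanges two positions of the code. *)
Definition swapn (k i : nat) (u : seq nat) : seq nat :=
  [seq nth 0%N u (tpn k i j) | j <- iota 0 4].

Lemma code_tperm (k i : 'I_4) g : code (tperm k i * g)%g = swapn k i (code g).
Proof.
rewrite /swapn -map_enum_ord /code; apply: eq_map => j /=.
rewrite permM -nth_code; congr nth.
by rewrite permE /tpn /= -!val_eqE; case: ifP => // _; case: ifP.
Qed.

Lemma code1 : code 1%g = iota 0 4.
Proof. by rewrite -val_enum_ord; apply: eq_map => j; rewrite perm1. Qed.

Lemma gmulA a b c : gmul (gmul a b) c = gmul a (gmul b c).
Proof.
apply/ffunP => g; rewrite !ffunE.
under eq_bigr => h _ do rewrite ffunE mulr_suml.
rewrite exchange_big; apply: eq_bigr => k _.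
rewrite ffunE mulr_sumr (reindex_inj (mulgI k)); apply: eq_bigr => h _.
by rewrite mulKg invMg mulgA mulrA.
Qed.

Lemma gmul_deltal t z g : gmul (gdelta t) z g = z (t^-1 * g)%g.
Proof.
rewrite ffunE (bigD1 t) //= ffunE eqxx mul1r big1 ?addr0 // => h /negPf ne.
by rewrite ffunE ne mul0r.
Qed.

Lemma gmul_deltar t z g : gmul z (gdelta t) g = z (g * t^-1)%g.
Proof.
rewrite ffunE (bigD1 (g * t^-1)%g) //= ffunE invMg invgK -mulgA mulVg mulg1 eqxx mulr1.
rewrite big1 ?addr0 // => h ne.
rewrite ffunE; case: eqP => [e|_]; last by rewrite mulr0.
by rewrite -e invMg invgK mulKVg eqxx in ne.
Qed.

Lemma gmul1l z : gmul gone z = z.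
Proof. by apply/ffunP => g; rewrite gmul_deltal invg1 mul1g. Qed.

Lemma gmul_suml (I : Type) (r : seq I) (P : pred I) (F : I -> ZS4) z :
  gmul (\sum_(i <- r | P i) F i) z = \sum_(i <- r | P i) gmul (F i) z.
Proof.
apply/ffunP => g; rewrite sum_ffunE ffunE.
under eq_bigr => h _ do rewrite sum_ffunE mulr_suml.
by rewrite exchange_big; apply: eq_bigr => i _; rewrite ffunE.
Qed.

Lemma gmul_sumr (I : Type) (r : seq I) (P : pred I) (F : I -> ZS4) z :
  gmul z (\sum_(i <- r | P i) F i) = \sum_(i <- r | P i) gmul z (F i).
Proof.
apply/ffunP => g; rewrite sum_ffunE ffunE.
under eq_bigr => h _ do rewrite sum_ffunE mulr_sumr.
by rewrite exchange_big; apply: eq_bigr => i _; rewrite ffunE.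
Qed.

Lemma mulrz_ffunE (z : ZS4) (c : int) g : (z *~ c) g = z g * c.
Proof.
case: c => n; rewrite ?NegzE ?mulrNz; last first.
  by rewrite ffunE -pmulrn ffunMnE -mulr_natr mulrN natz.
by rewrite -pmulrn ffunMnE -mulr_natr natz.
Qed.

Lemma gmul_mulrzr a b c : gmul a (b *~ c) = gmul a b *~ c.
Proof.
apply/ffunP => g; rewrite mulrz_ffunE !ffunE mulr_suml; apply: eq_bigr => h _.
by rewrite mulrz_ffunE mulrA.
Qed.

Definition codefun (f : seq nat -> int) : ZS4 := [ffun g => f (code g)].

(** Left multiplication by [JM i], transported to codes; a [foldr] over a concrete list, unlike a
    big operator, can be evaluated by [vm_compute]. *)
Definition act (i : nat) (f : seq nat -> int) (u : seq nat) : int :=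
  foldr (fun k acc => f (swapn k i u) + acc) 0 (iota 0 i).

Lemma JM_codefun (i : 'I_4) f : gmul (JM i) (codefun f) = codefun (act i f).
Proof.
apply/ffunP => g; rewrite gmul_suml sum_ffunE ffunE.
transitivity (\sum_(k < 4 | (k < i)%N) f (swapn k i (code g))).
  by apply: eq_bigr => k _; rewrite gmul_deltal ffunE tpermV code_tperm.
rewrite (big_ord_narrow (ltnW (ltn_ord i))) /=.
rewrite -(big_mkord xpredT (fun k => f (swapn k i (code g)))).
by rewrite /act unlock /reducebig /index_iota subn0; elim: iota => //= k s ->.
Qed.

(** * Simultaneous eigenvectors of the Jucys-Murphy elements *)

(* Contents of the entries 2, 3, 4 of the ten standard tableaux; entry 1 always has content 0. *)
Definition tableaux : seq (int * int * int) :=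
  [:: (1,2,3); (1,2,-1); (1,-1,2); (-1,1,2); (1,-1,0); (-1,1,0);
      (-1,-2,1); (-1,1,-2); (1,-1,-2); (-1,-2,-3)].
Definition other_contents (t : int * int * int) : seq int :=
  let: (l2, l3, l4) := t in
  rem l4 (if l3 == 2 then [:: 3; -1] else if l3 == -2 then [:: -3; 1] else [:: 2; 0; -2]).
(* [murphy t] is a multiple of Young's seminormal idempotent: Lagrange interpolation removes
   every other content the entries 2, 3, 4 could have, one entry at a time, and [murphy_wt t]
   normalises the result to 48 times the idempotent. *)
Definition mulL (i : nat) (c : int) (f : seq nat -> int) (u : seq nat) : int :=
  act i f u - c * f u.
Definition murphy (t : int * int * int) : seq nat -> int :=
  let: (l2, l3, l4) := t in
  foldr (mulL 3) (mulL 2 (l2 - l3) (mulL 1 (- l2) (fun u => (u == iota 0 4)%:R))) (other_contents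
    t).
Definition murphy_wt (t : int * int * int) : int :=
  let: (l2, l3, l4) := t in
  (48 %/ foldr (fun c r => (l4 - c) * r) ((l2 + l2) * (l3 + l3 - l2)) (other_contents t))%Z.

Lemma murphy_eigen : all (fun t => all (fun u =>
   [&& act 1 (murphy t) u == t.1.1 * murphy t u,
       act 2 (murphy t) u == t.1.2 * murphy t u &
       act 3 (murphy t) u == t.2 * murphy t u]) codes) tableaux.
Proof. by vm_compute. Qed.

(** The seminormal idempotents sum to 1. The interpolation denominators are 24 or 48 up to sign, so
    48 is the least factor that makes all weights integral. *)
Lemma murphy_sum : all (fun u => foldr (fun t r => murphy_wt t * murphy t u + r) 0 tableaux ==
   48 * (u == iota 0 4)%:R) codes.
Proof. by vm_compute. Qed.

Definition cont (t : int * int * int) (i : nat) : int :=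
  nth 0 [:: 0; t.1.1; t.1.2; t.2] i.

Lemma gmulr1 z : gmul z gone = z.
Proof. by apply/ffunP => g; rewrite gmul_deltar invg1 mulg1. Qed.

Lemma JM_murphy t (i : 'I_4) : t \in tableaux ->
  gmul (JM i) (codefun (murphy t)) = codefun (murphy t) *~ cont t i.
Proof.
move=> tin; apply/ffunP => g; rewrite JM_codefun mulrz_ffunE !ffunE mulrC.
have /and3P [/eqP e1 /eqP e2 /eqP e3] := allP (allP murphy_eigen t tin) _ (code_in g).
by case: i => [] [|[|[|[|//]]]] //= _; rewrite /cont /= ?e1 ?e2 ?e3 // mul0r.
Qed.

Definition mono4 (t : int * int * int) (a : seq nat) : int :=
  \prod_(i <- enum 'I_4) cont t i ^+ nth 0%N a i.

Lemma JMmono_murphy t a : t \in tableaux ->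
  gmul (JMmono a) (codefun (murphy t)) = codefun (murphy t) *~ mono4 t a.
Proof.
move=> tin; rewrite /JMmono /mono4; elim: (enum 'I_4) => [|i r IH] /=.
  by rewrite big_nil gmul1l.
rewrite big_cons gmulA IH gmul_mulrzr mulrzA; congr (_ *~ _).
elim: (nth _ _ _) => [|n IHn]; first by rewrite gmul1l.
by rewrite /gexp /= gmulA [gmul (iter _ _ _) _]IHn gmul_mulrzr JM_murphy // exprS mulrzA.
Qed.

Lemma gone_murphy : gone *~ 48 = \sum_(t <- tableaux) codefun (murphy t) *~ murphy_wt t.
Proof.
apply/ffunP => g; rewrite mulrz_ffunE ffunE sum_ffunE.
have /eqP := allP murphy_sum _ (code_in g).
rewrite -code1 (inj_eq code_inj) mulrC natz => <-.
by rewrite unlock /=; do !congr (_ + _); rewrite mulrz_ffunE ffunE mulrC.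
Qed.

(** Multiplying by the identity, expanded in eigenvectors, turns each monomial into its value at the
    contents. *)
Lemma sum_JMmono (s : seq (seq nat)) g :
  (\sum_(a <- s) JMmono a) g * 48 =
  \sum_(t <- tableaux) murphy_wt t * murphy t (code g) * \sum_(a <- s) mono4 t a.
Proof.
rewrite -mulrz_ffunE -(gmulr1 (\sum_(a <- s) _)) -gmul_mulrzr gone_murphy gmul_suml sum_ffunE.
under [RHS]eq_bigr => t _ do rewrite mulr_sumr.
rewrite exchange_big; apply: eq_bigr => a _.
rewrite gmul_sumr sum_ffunE; apply: eq_big_seq => t tin.
by rewrite gmul_mulrzr JMmono_murphy // !mulrz_ffunE ffunE mulrC mulrA [murphy_wt t * _]mulrC
  mulrAC mulrC mulrA.
Qed.

(** * Monomial symmetric functions of the contents *)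

Lemma mono4E t a : mono4 t a = 0 ^+ nth 0%N a 0 *
  (t.1.1 ^+ nth 0%N a 1 * (t.1.2 ^+ nth 0%N a 2 * t.2 ^+ nth 0%N a 3)).
Proof. by rewrite /mono4 !enum_ordSl enum_ord0 !big_cons big_nil mulr1. Qed.

Definition mono3 (t : int * int * int) (a : seq nat) : int :=
  t.1.1 ^+ nth 0%N a 0 * (t.1.2 ^+ nth 0%N a 1 * t.2 ^+ nth 0%N a 2).

Definition Msum (s : seq nat) (t : int * int * int) : int :=
  \sum_(a <- permutations s) mono3 t a.

Lemma sum_permutations (R : nmodType) (T : eqType) (s : seq T) (F : seq T -> R) :
  (0 < size s)%N ->
  \sum_(a <- permutations s) F a =
  \sum_(x <- undup s) \sum_(b <- permutations (rem x s)) F (x :: b).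
Proof.
by move=> s0; rewrite (perm_big _ (permutationsE s0)) big_allpairs_dep.
Qed.

(** Entry 1 has content 0, so only rearrangements with first exponent 0 survive. *)
Lemma sum_mono4 s t :
  \sum_(a <- permutations (0%N :: s)) mono4 t a = Msum s t.
Proof.
rewrite sum_permutations // (bigD1_seq 0%N) ?undup_uniq ?mem_undup ?mem_head //=.
rewrite [X in _ + X]big1_seq ?addr0; last first.
  move=> x /andP [nex _]; rewrite big1 // => b _.
  by rewrite mono4E /= expr0n (negPf nex) mul0r.
by apply: eq_bigr => b _; rewrite mono4E /= expr0 mul1r.
Qed.

(* [pw] is the power function, or its reduction modulo some integer. *)
Definition sym_iii (pw : int -> nat -> int) i (t : int * int * int) : int :=
  let: (x, y, z) := t in pw x i * (pw y i * pw z i).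
Definition sym_iik (pw : int -> nat -> int) i k (t : int * int * int) : int :=
  let: (x, y, z) := t in
  pw x i * (pw y i * pw z k) + pw x i * (pw y k * pw z i) + pw x k * (pw y i * pw z i).
Definition sym_ijk (pw : int -> nat -> int) i j k (t : int * int * int) : int :=
  let: (x, y, z) := t in
  pw x i * (pw y j * pw z k) + pw x i * (pw y k * pw z j) + pw x j * (pw y i * pw z k)
  + pw x j * (pw y k * pw z i) + pw x k * (pw y i * pw z j) + pw x k * (pw y j * pw z i).

Lemma Msum_iii i t : Msum [:: i; i; i] t = sym_iii expz i t.
Proof.
case: t => [[x y] z]; rewrite /Msum.
do 3!(rewrite sum_permutations // /undup ?inE ?eqxx /= ?big_cons big_nil /= ?eqxx ?addr0).
by rewrite big_cons big_nil addr0.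
Qed.

Lemma Msum_iik i k t : i != k -> Msum [:: i; i; k] t = sym_iik expz i k t.
Proof.
move=> ik; have ki : k != i by rewrite eq_sym.
case: t => [[x y] z]; rewrite /Msum.
do 3!(rewrite !sum_permutations // /undup ?inE ?eqxx ?(negPf ik) ?(negPf ki) /= ?eqxx ?(negPf ik)
  ?(negPf ki) /= ?big_cons ?big_nil /= ?eqxx ?addr0 ?(negPf ik) ?(negPf ki)).
by rewrite !big_cons !big_nil !addr0.
Qed.

Lemma Msum_ijk i j k t : i != j -> i != k -> j != k -> Msum [:: i; j; k] t = sym_ijk expz i j k t.
Proof.
move=> ij ik jk; have ji : j != i by rewrite eq_sym.
have ki : k != i by rewrite eq_sym.
have kj : k != j by rewrite eq_sym.
pose E := (negPf ij, negPf ik, negPf jk, negPf ji, negPf ki, negPf kj).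
case: t => [[x y] z]; rewrite /Msum.
do 3!(rewrite !sum_permutations // /undup ?inE ?eqxx ?E /= ?eqxx ?E /= ?big_cons ?big_nil /=
  ?eqxx ?addr0 ?E).
by rewrite !big_cons !big_nil !addr0 !addrA.
Qed.

Lemma Msum_perm s s' t : perm_eq s s' -> Msum s t = Msum s' t.
Proof. by move=> e; rewrite /Msum (perm_big _ (perm_permutations e)). Qed.

(** The two adjacent exchanges generate all reorderings, so tableaux of one shape give one
    scalar. *)
Lemma Msum_sym s x y z : size s = 3 ->
  (Msum s (x, y, z) = Msum s (y, x, z)) * (Msum s (x, y, z) = Msum s (x, z, y)).
Proof.
case: s => [|i [|j [|k [|//]]]] // _.
have [<-|ij] := eqVneq i j.
  have [<-|ik] := eqVneq i k; first by rewrite !Msum_iii /=; split; ring.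
  by rewrite !Msum_iik //=; split; ring.
have [<-|ik] := eqVneq i k.
  have e : perm_eq [:: i; j; i] [:: i; i; j].
    by rewrite perm_cons; apply/permPl; exact: (perm_catC [:: j] [:: i]).
  by rewrite !(Msum_perm _ e) !Msum_iik //=; split; ring.
have [<-|jk] := eqVneq j k; last by rewrite !Msum_ijk //=; split; ring.
have e : perm_eq [:: i; j; j] [:: j; j; i] by apply/permPl; exact: (perm_catC [:: i] [:: j; j]).
by rewrite !(Msum_perm _ e) !Msum_iik 1?eq_sym //=; split; ring.
Qed.

Lemma Msum_opp s x y z : size s = 3 ->
  Msum s (- x, - y, - z) = (-1) ^+ sumn s * Msum s (x, y, z).
Proof.
move=> s3; rewrite /Msum mulr_sumr; apply: eq_big_seq => a.
rewrite mem_permutations => /[dup] /perm_sumn <- /perm_size; rewrite s3.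
case: a => [|i [|j [|k [|//]]]] // _; rewrite /mono3 /= addn0.
rewrite -[- x]mulN1r -[- y]mulN1r -[- z]mulN1r !exprMn !exprD; ring.
Qed.

(** * Conjugacy classes and coordinates of central elements *)

Definition rep (c : nat) : seq nat :=
  nth [::] [:: [:: 0; 1; 2; 3]; [:: 1; 2; 0; 3]; [:: 1; 0; 3; 2]; [:: 1; 0; 2; 3];
               [:: 1; 2; 3; 0]]%N c.

(** Fixed points determine the class in S_4, except that double transpositions and 4-cycles both
    have none; squaring separates these two. *)
Definition cls (u : seq nat) : nat :=
  match count (fun i => nth 0%N u i == i) (iota 0 4) with
  | 4 => 0 | 1 => 1 | 2 => 3 | _ => if compc u u == iota 0 4 then 2 else 4
  end.

(** The witness [s] conjugates [u] to its representative; the relation is written without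
    inverses. *)
Lemma cls_rep : all (fun u => has (fun s => compc u s == compc s (rep (cls u))) codes) codes.
Proof. by vm_compute. Qed.
Lemma cls_comm : all (fun u => all (fun v => cls (compc u v) == cls (compc v u)) codes) codes.
Proof. by vm_compute. Qed.

Lemma cls_lt u : (cls u < 5)%N.
Proof. by rewrite /cls; case: count => [|[|[|[|[|n]]]]] //; case: ifP. Qed.

Lemma rep_codes c : (c < 5)%N -> rep c \in codes.
Proof. by case: c => [|[|[|[|[|//]]]]]; vm_compute. Qed.

Definition rperm (c : nat) : 'S_4 := odflt 1%g [pick g | code g == rep c].

Lemma code_rperm c : (c < 5)%N -> code (rperm c) = rep c.
Proof.
move=> /rep_codes /codesP [g e]; rewrite /rperm.
by case: pickP => [h /eqP //|/(_ g)]; rewrite e eqxx.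
Qed.

Definition class_fun (z : ZS4) := forall g, z g = z (rperm (cls (code g))).

Lemma central_class_fun z : central z <-> class_fun z.
Proof.
split=> [cz g|cz x].
  have /hasP [_ /codesP [h <-] /eqP] := allP cls_rep _ (code_in g).
  rewrite -(code_rperm (cls_lt _)) -!code_mul => /code_inj e.
  have /ffunP /(_ (h^-1 * g)%g) := cz (gdelta h^-1%g).
  by rewrite gmul_deltal gmul_deltar !invgK mulKVg -mulgA e mulKg => <-.
(* Reindexing aligns the factors of x and leaves z at g k^-1 against z at k^-1 g, which are
   conjugate. *)
apply/ffunP => g; rewrite !ffunE (reindex_inj invg_inj) (reindex_inj (mulIg g^-1%g)) /=.
apply: eq_bigr => k _; rewrite invgK mulgKV invMg invgK [LHS]mulrC; congr (_ * _).
rewrite cz [RHS]cz !code_mul.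
by rewrite (eqP (allP (allP cls_comm _ (code_in g)) _ (code_in k^-1%g))).
Qed.

(** Young's idempotents of one shape add up to the central idempotent, so the entries are 2 chi(1)
    chi(u) for the shapes (4), (3,1), (2,2), (2,1,1), (1,1,1,1). *)
Definition class_coef (u : seq nat) : seq int :=
  let f t := murphy_wt t * murphy t u in
  [:: f (1,2,3); f (-1,1,2) + f (1,-1,2) + f (1,2,-1); f (1,-1,0) + f (-1,1,0);
      f (1,-1,-2) + f (-1,1,-2) + f (-1,-2,1); f (-1,-2,-3)].

Lemma class_coef_cls : all (fun u => class_coef u == class_coef (rep (cls u))) codes.
Proof. by vm_compute. Qed.

(* The element m_mu for mu obtained from [s], of size 3, by deleting zeros; L_1 = 0 leaves at
   most three nonzero parts. *)
Definition tripZ (s : seq nat) : ZS4 := \sum_(a <- permutations (0%N :: s)) JMmono a.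

Lemma tripZE s g : size s = 3 ->
  tripZ s g * 48 = let f := nth 0 (class_coef (code g)) in
  f 0%N * Msum s (1,2,3) + f 1%N * Msum s (-1,1,2) + f 2%N * Msum s (0,1,-1) +
  f 3%N * Msum s (1,-1,-2) + f 4%N * Msum s (-1,-2,-3).
Proof.
move=> s3; rewrite /tripZ sum_JMmono.
under eq_bigr => t _ do rewrite sum_mono4.
have e1 : (Msum s (1,2,-1) = Msum s (-1,1,2)) * (Msum s (1,-1,2) = Msum s (-1,1,2)).
  have e := (Msum_sym 1 (-1) 2 s3).1.
  by split; rewrite ?e // ((Msum_sym 1 2 (-1) s3).2).
have e2 : (Msum s (1,-1,0) = Msum s (0,1,-1)) * (Msum s (-1,1,0) = Msum s (0,1,-1)).
  have e : Msum s (1,-1,0) = Msum s (0,1,-1).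
    by rewrite (Msum_sym 1 (-1) 0 s3).2 (Msum_sym 1 0 (-1) s3).1.
  by split=> //; rewrite (Msum_sym (-1) 1 0 s3).1.
have e3 : (Msum s (-1,-2,1) = Msum s (1,-1,-2)) * (Msum s (-1,1,-2) = Msum s (1,-1,-2)).
  have e := (Msum_sym (-1) 1 (-2) s3).1.
  by split; rewrite ?e // ((Msum_sym (-1) (-2) 1 s3).2).
rewrite /tableaux !big_cons big_nil !e1 !e2 !e3 /class_coef /=; ring.
Qed.

Lemma tripZ_class s : size s = 3 -> class_fun (tripZ s).
Proof.
move=> s3 g; apply: (@mulIf int 48) => //.
by rewrite !tripZE // code_rperm ?cls_lt // -(eqP (allP class_coef_cls _ (code_in g))).
Qed.

Definition crd (c : nat) (z : ZS4) : int := z (rperm c).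

(** Conjugate shapes are merged by [Msum_opp], which leaves the values at the shapes (4), (3,1) and
    (2,2). *)
Lemma tripZ_crd s c : size s = 3 -> (c < 5)%N ->
  crd c (tripZ s) * 48 = let f := nth 0 (class_coef (rep c)) in
  (f 0%N + (-1) ^+ sumn s * f 4%N) * Msum s (1,2,3) +
  (f 1%N + (-1) ^+ sumn s * f 3%N) * Msum s (-1,1,2) + f 2%N * Msum s (0,1,-1).
Proof.
move=> s3 c5; rewrite /crd tripZE // code_rperm //=.
have := Msum_opp (-1) 1 2 s3; rewrite opprK => ->.
rewrite (Msum_opp 1 2 3 s3); ring.
Qed.

(** Negation permutes the contents of the self-conjugate shape (2,2), so in odd degree the value is
    its own negative. *)
Lemma Msum_odd0 s : size s = 3 -> odd (sumn s) -> Msum s (0, 1, -1) = 0.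
Proof.
move=> s3 os; have := Msum_opp 0 1 (-1) s3; rewrite opprK oppr0 -signr_odd os.
rewrite (Msum_sym 0 1 (-1) s3).2 expr1 mulN1r; move: (Msum _ _) => m; lia.
Qed.

Lemma class_coef_rep :
  [/\ class_coef (rep 0) = [:: 2; 18; 8; 18; 2], class_coef (rep 1) = [:: 2; 0; - 4; 0; 2],
      class_coef (rep 2) = [:: 2; - 6; 8; - 6; 2], class_coef (rep 3) = [:: 2; 6; 0; - 6; - 2]
    & class_coef (rep 4) = [:: 2; - 6; 0; 6; - 2]].
Proof. by split; vm_compute. Qed.

Section Coordinates.
Variable s : seq nat.
Hypothesis s3 : size s = 3.
Let a := Msum s (1, 2, 3).
Let b := Msum s (-1, 1, 2).
Let c := Msum s (0, 1, -1).

Lemma tripZ_even : ~~ odd (sumn s) ->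
  [/\ crd 0 (tripZ s) * 12 = a + 9 * b + 2 * c, crd 1 (tripZ s) * 12 = a - c,
      crd 2 (tripZ s) * 12 = a + 2 * c - 3 * b, crd 3 (tripZ s) = 0
    & crd 4 (tripZ s) = 0].
Proof.
move=> /negPf es.
have E i : (i < 5)%N -> _ := fun h => tripZ_crd s3 h.
rewrite -signr_odd es expr0 -/a -/b -/c in E.
have := (E 0%N isT, E 1%N isT, E 2%N isT, E 3%N isT, E 4%N isT).
case: class_coef_rep => -> -> -> -> -> /=.
move: a b c (crd 0 _) (crd 1 _) (crd 2 _) (crd 3 _) (crd 4 _) => {E}.
by move=> ? ? ? ? ? ? ? ? [] [] [] [] *; split; lia.
Qed.

Lemma tripZ_odd : odd (sumn s) ->
  [/\ crd 3 (tripZ s) * 12 = a + 3 * b, crd 4 (tripZ s) * 12 = a - 3 * b,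
      crd 0 (tripZ s) = 0, crd 1 (tripZ s) = 0 & crd 2 (tripZ s) = 0].
Proof.
move=> os; have := Msum_odd0 s3 os.
have E i : (i < 5)%N -> _ := fun h => tripZ_crd s3 h.
rewrite -signr_odd os expr1 -/a -/b -/c in E.
have := (E 0%N isT, E 1%N isT, E 2%N isT, E 3%N isT, E 4%N isT).
case: class_coef_rep => -> -> -> -> -> /=.
rewrite -/c; move: a b c (crd 0 _) (crd 1 _) (crd 2 _) (crd 3 _) (crd 4 _) => {E}.
by move=> ? ? ? ? ? ? ? ? [] [] [] [] *; split; lia.
Qed.
End Coordinates.

Lemma tripZ_perm s s' : perm_eq s s' -> tripZ s = tripZ s'.
Proof.
move=> e; rewrite /tripZ; apply: perm_big; apply: perm_permutations.
by rewrite perm_cons.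
Qed.

Lemma m_mu_tripZ mu : (size mu <= 3)%N -> m_mu mu = tripZ (mu ++ nseq (3 - size mu) 0%N).
Proof.
move=> mu3; rewrite /m_mu leqW // /tripZ; apply: perm_big; apply: perm_permutations.
by rewrite subSn // perm_catC /= perm_cons perm_catC.
Qed.

(** With four positive parts every monomial contains L_1 = 0; with more parts the value is 0 by
    definition. *)
Lemma m_mu_large mu : is_partition mu -> (3 < size mu)%N -> m_mu mu = 0.
Proof.
case/andP=> _ pos mu3; rewrite /m_mu; case: ifP => // mu4.
have -> : (4 - size mu = 0)%N by lia.
rewrite cats0; apply/ffunP => g; apply: (@mulIf int 48) => //.
rewrite sum_JMmono ffunE mul0r big1 // => t _.
rewrite big1_seq ?mulr0 // => a /andP [_]; rewrite mem_permutations => e.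
move: pos mu3; rewrite -(perm_all _ e) -(perm_size e) mono4E.
by case: a {e} => //= x a /andP [x0 _] _; rewrite expr0n gtn_eqF // mul0r.
Qed.

Lemma m_mu_triple mu : is_partition mu -> m_mu mu = 0 \/
  exists i j k, [/\ (j <= i)%N, (k <= j)%N & m_mu mu = tripZ [:: i; j; k]].
Proof.
move=> pmu; case: (leqP (size mu) 3) => mu3; last by left; exact: m_mu_large.
right; rewrite m_mu_tripZ //; move: pmu => /andP [+ _].
case: mu mu3 => [|i [|j [|k [|l mu]]]] //= _.
- by exists 0%N, 0%N, 0%N.
- by exists i, 0%N, 0%N.
- by rewrite andbT => ij; exists i, j, 0%N.
- by case/and3P=> ij jk _; exists i, j, k.
Qed.

(** * Reduction modulo small integers *)

(** [T] is a preperiod and [P] a period; any argument from [T + P] on can be lowered by [P]. *)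
Lemma periodic_all (f : nat -> bool) T P : (0 < P)%N ->
  (forall n, (T <= n)%N -> f (n + P)%N = f n) -> all f (iota 0 (T + P)) -> forall n, f n.
Proof.
move=> P0 fP /allP fT; elim/ltn_ind => n IH.
have [lt_n|ge_n] := ltnP n (T + P); first by apply: fT; rewrite mem_iota.
by rewrite -(subnK (leq_trans (leq_addl T P) ge_n)) fP ?IH; lia.
Qed.

Lemma periodic_all2 (f : nat -> nat -> bool) T P : (0 < P)%N ->
  (forall m n, (T <= m)%N -> f (m + P)%N n = f m n) ->
  (forall m n, (T <= n)%N -> f m (n + P)%N = f m n) ->
  all (fun m => all (f m) (iota 0 (T + P))) (iota 0 (T + P)) -> forall m n, f m n.
Proof.
move=> P0 fPl fPr h m; apply: (@periodic_all (f m) T P P0) => [n|]; first exact: fPr.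
move: m; apply: (@periodic_all (fun m => all (f m) _) T P) => // n Tn.
by apply: eq_all => k; exact: fPl.
Qed.

(** Reducing at every step keeps the numbers small under [vm_compute]. *)
Definition pow_mod (M x : int) (n : nat) : int := iter n (fun r => ((x * r) %% M)%Z) (1 %% M)%Z.

Lemma pow_modE M x n : pow_mod M x n = (x ^+ n %% M)%Z.
Proof. by elim: n => //= n ->; rewrite modzMmr exprS. Qed.

Lemma pow_mod_period M x T P n : pow_mod M x (T + P) = pow_mod M x T -> (T <= n)%N ->
  pow_mod M x (n + P) = pow_mod M x n.
Proof.
have D m k : pow_mod M x (m + k) = iter m (fun r => ((x * r) %% M)%Z) (pow_mod M x k) by rewrite
  /pow_mod iterD.
by move=> e /subnK <-; rewrite -addnA D e -D.
Qed.

Lemma eqmodD (M a b a' b' : int) : (a = a' %[mod M])%Z -> (b = b' %[mod M])%Z ->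
  (a + b = a' + b' %[mod M])%Z.
Proof. by move=> ea eb; rewrite -modzDm ea eb modzDm. Qed.

Lemma eqmodM (M a b a' b' : int) : (a = a' %[mod M])%Z -> (b = b' %[mod M])%Z ->
  (a * b = a' * b' %[mod M])%Z.
Proof. by move=> ea eb; rewrite -modzMm ea eb modzMm. Qed.

Lemma eqmod_pow_mod M x n : (x ^+ n = pow_mod M x n %[mod M])%Z.
Proof. by rewrite pow_modE modz_mod. Qed.

Ltac eqmod := do ?[exact: eqmod_pow_mod | exact: erefl | apply: eqmodM | apply: eqmodD].

Lemma sym_iii_mod M i t : (sym_iii expz i t = sym_iii (pow_mod M) i t %[mod M])%Z.
Proof. by case: t => [[x y] z]; rewrite /sym_iii; eqmod. Qed.
Lemma sym_iik_mod M i k t : (sym_iik expz i k t = sym_iik (pow_mod M) i k t %[mod M])%Z.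
Proof. by case: t => [[x y] z]; rewrite /sym_iik; eqmod. Qed.
Lemma sym_ijk_mod M i j k t : (sym_ijk expz i j k t = sym_ijk (pow_mod M) i j k t %[mod M])%Z.
Proof. by case: t => [[x y] z]; rewrite /sym_ijk; eqmod. Qed.

Definition trip_res (F : int * int * int -> int) : int * int * int :=
  ((F (1, 2, 3) %% 8)%Z, (F (-1, 1, 2) %% 8)%Z, (F (0, 1, -1) %% 8)%Z).

(** The preperiod 3 comes from the base 2, the period 2 from the bases 3 and -1. *)
Lemma pow_mod8_period x n : x \in [:: 0; 1; 2; 3; -1] -> (3 <= n)%N -> pow_mod 8 x (n + 2) =
  pow_mod 8 x n.
Proof.
by rewrite !inE => /or4P [/eqP -> | /eqP -> | /eqP -> | /orP [/eqP -> | /eqP ->]];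
  apply: pow_mod_period; vm_compute.
Qed.

(* The residues mod 8 of the three character values determine the parities of the
   coordinates: 12 q = a - c, 4 (r - q) = c - b, p - r = b on the even side and
   12 y = a - 3 b, 2 (x - y) = b on the odd side. *)
Definition even_par (r : int * int * int) : bool * bool * bool :=
  let: (a, b, c) := r in
  let q := ~~ (8 %| a - c)%Z in let r := q (+) ~~ (8 %| c - b)%Z in (r (+) ~~ (2 %| b)%Z, q, r).
Definition odd_par (r : int * int * int) : bool * bool :=
  let: (a, b, c) := r in
  let y := ~~ (8 %| a - 3 * b)%Z in (y (+) ~~ (4 %| b)%Z, y).
Definition even0 r := even_par r == (false, false, false).
Definition odd0 r := odd_par r == (false, false).

Lemma sym_iii_parity i :
  (if odd i then (i == 1) || odd0 (trip_res (sym_iii (pow_mod 8) i))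
   else [|| i == 0, i == 2 | even0 (trip_res (sym_iii (pow_mod 8) i))])%N.
Proof.
move: i; apply: (@periodic_all _ 3 2) => [//|n n3|]; last by vm_compute.
rewrite /trip_res /sym_iii !pow_mod8_period // oddD addbF.
have [-> -> ->] : [/\ (n + 2 == 1 = (n == 1)), (n + 2 == 0 = (n == 0)) & (n + 2 == 2 = (n == 2))]%N.
  by split; lia.
by [].
Qed.

(** On the diagonal [sym_iik] counts the single rearrangement three times. The diagonal is exempted
    only below the preperiod, because exempting it everywhere would destroy periodicity in each
    variable; beyond that the claim holds for the formula as it stands. *)
Lemma sym_iik_parity i k :
  [|| (i < 3) && (i == k) |
  if odd k then [|| i == 0, k == 1 | odd0 (trip_res (sym_iik (pow_mod 8) i k))]
   else [|| k == 0, k == 2 | even0 (trip_res (sym_iik (pow_mod 8) i k))]]%N.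
Proof.
move: i k; apply: (@periodic_all2 _ 3 2) => [//|i k n3|i k n3|]; last by vm_compute.
  rewrite /trip_res /sym_iik !pow_mod8_period //.
  have [-> ->] : [/\ ((i + 2 < 3) && (i + 2 == k) = (i < 3) && (i == k)) & (i + 2 == 0 = (i ==
    0))]%N.
    by split; lia.
  by [].
rewrite /trip_res /sym_iik !pow_mod8_period // oddD addbF.
have [-> -> -> ->] : [/\ ((i < 3) && (i == k + 2) = (i < 3) && (i == k)),
   (k + 2 == 1 = (k == 1)), (k + 2 == 0 = (k == 0)) & (k + 2 == 2 = (k == 2))]%N.
  by split; lia.
by [].
Qed.

Lemma sym_ijk_parity i j k :
  [|| (i < 3) && ((i == j) || (i == k)), (j < 3) && (j == k) |
   if odd (i + j + k) then [|| i == 0, j == 0, k == 0 | odd0 (trip_res (sym_ijk (pow_mod 8) i j k))]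
   else even0 (trip_res (sym_ijk (pow_mod 8) i j k))]%N.
Proof.
move: k; apply: (@periodic_all _ 3 2) => [//|k k3|].
  rewrite /trip_res /sym_ijk !pow_mod8_period // !oddD addbF.
  have -> : ((i < 3) && ((i == j) || (i == k + 2)) = (i < 3) && ((i == j) || (i == k)))%N by lia.
  have -> : ((j < 3) && (j == k + 2) = (j < 3) && (j == k))%N by lia.
  have -> : ((k + 2 == 0) = (k == 0))%N by lia.
  by [].
move: i j; apply: (@periodic_all2 _ 3 2) => [//|i j n3|i j n3|]; last by vm_compute.
  apply: eq_all => k; rewrite /trip_res /sym_ijk !pow_mod8_period // !oddD addbF.
  have -> : ((i + 2 < 3) && ((i + 2 == j) || (i + 2 == k)) = (i < 3) && ((i == j) || (i == k)))%N
    by lia.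
  have -> : ((i + 2 == 0) = (i == 0))%N by lia.
  by [].
apply: eq_all => k; rewrite /trip_res /sym_ijk !pow_mod8_period // !oddD addbF.
have -> : ((i < 3) && ((i == j + 2) || (i == k)) = (i < 3) && ((i == j) || (i == k)))%N by lia.
have -> : ((j + 2 == 0) = (j == 0))%N by lia.
have -> : ((j + 2 < 3) && (j + 2 == k) = (j < 3) && (j == k))%N by lia.
by [].
Qed.

(** The clauses serve the families (i,i,2), (i,i), (i,i,1) and (i), in this order. *)
Lemma sym_iik_kind i : [&& even_par (trip_res (sym_iik (pow_mod 8) i 2)) == (false, true, false),
  even_par (trip_res (sym_iik (pow_mod 8) i 0)) == (if odd i then (false, true, true) else (true,
    false, false)),
  odd_par (trip_res (sym_iik (pow_mod 8) i 1)) == (if i == 0%N then (true, false) else (false,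
    true)) &
  ~~ odd i || (i == 1%N) || (odd_par (trip_res (sym_iik (pow_mod 8) 0 i)) == (true, true))].
Proof.
move: i; apply: (@periodic_all _ 3 2) => [//|n n3|]; last by vm_compute.
rewrite /trip_res /sym_iik !pow_mod8_period // oddD addbF.
have [-> ->] : (n + 2 == 1 = (n == 1))%N /\ (n + 2 == 0 = (n == 0))%N by split; lia.
by [].
Qed.

Lemma sym_ijk_kind i j : [|| odd i (+) ~~ odd j, i == 0, j == 0 |
   odd_par (trip_res (sym_ijk (pow_mod 8) i j 0)) == (true, true)]%N.
Proof.
move: i j; apply: (@periodic_all2 _ 3 2) => [//|i j n3|i j n3|]; last by vm_compute.
  rewrite /trip_res /sym_ijk !pow_mod8_period // !oddD !addbF.
  by have -> : (i + 2 == 0 = (i == 0))%N by lia.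
rewrite /trip_res /sym_ijk !pow_mod8_period // !oddD !addbF.
by have -> : (j + 2 == 0 = (j == 0))%N by lia.
Qed.

(** * Parities of the coordinates *)

Definition oddz (x : int) : bool := odd `|x|%N.

Lemma oddzM x y : oddz (x * y) = oddz x && oddz y.
Proof. by rewrite /oddz abszM oddM. Qed.

Lemma oddzD x y : oddz (x + y) = oddz x (+) oddz y.
Proof. rewrite /oddz; lia. Qed.

Lemma oddzN x : oddz (- x) = oddz x.
Proof. by rewrite /oddz abszN. Qed.

Definition epar (z : ZS4) := (oddz (crd 0 z), oddz (crd 1 z), oddz (crd 2 z)).
Definition opar (z : ZS4) := (oddz (crd 3 z), oddz (crd 4 z)).

Lemma epar_tripZ s : size s = 3 -> ~~ odd (sumn s) ->
  epar (tripZ s) = even_par (trip_res (Msum s)).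
Proof.
move=> s3 /(tripZ_even s3) [+ + + _ _]; rewrite /epar /even_par /trip_res /oddz.
move: (crd 0 _) (crd 1 _) (crd 2 _) (Msum _ (1, 2, 3)) (Msum _ (-1, 1, 2)) (Msum _ (0, 1, -1)) =>
  p q r a b c hp hq hr.
have eqc : 12 * q = a - c by lia.
have erq : 4 * (r - q) = c - b by lia.
have epr : p - r = b by lia.
have oq : odd `|q| = ~~ (8 %| (a %% 8)%Z - (c %% 8)%Z)%Z by move: eqc; clear; lia.
have orq : odd `|r - q| = ~~ (8 %| (c %% 8)%Z - (b %% 8)%Z)%Z by move: erq; clear; lia.
have opr : odd `|p - r| = ~~ (2 %| (b %% 8)%Z)%Z by move: epr; clear; lia.
rewrite -oq -orq -opr -/(oddz p) -/(oddz q) -/(oddz r) -/(oddz (r - q)) -/(oddz (p - r)).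
by rewrite -oddzD subrKC -oddzD subrKC.
Qed.

Lemma opar_tripZ s : size s = 3 -> odd (sumn s) ->
  opar (tripZ s) = odd_par (trip_res (Msum s)).
Proof.
move=> s3 /(tripZ_odd s3) [+ + _ _ _]; rewrite /opar /odd_par /trip_res /oddz.
move: (crd 3 _) (crd 4 _) (Msum _ (1, 2, 3)) (Msum _ (-1, 1, 2)) => x y a b hx hy.
have ey : 12 * y = a - 3 * b by lia.
have exy : 2 * (x - y) = b by lia.
have oy : odd `|y| = ~~ (8 %| (a %% 8)%Z - 3 * (b %% 8)%Z)%Z by move: ey; clear; lia.
have oxy : odd `|x - y| = ~~ (4 %| (b %% 8)%Z)%Z by move: exy; clear; lia.
rewrite -oy -oxy -/(oddz x) -/(oddz y) -/(oddz (x - y)).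
by rewrite -oddzD subrKC.
Qed.

Lemma trip_res_eq F G : (forall t, (F t = G t %[mod 8])%Z) -> trip_res F = trip_res G.
Proof. by move=> e; rewrite /trip_res !e. Qed.

(** * Determinant expressions and exponential congruences *)

Definition det3 (u v w : nat -> int) : int :=
  u 0%N * (v 1%N * w 2%N - v 2%N * w 1%N) - u 1%N * (v 0%N * w 2%N - v 2%N * w 0%N)
  + u 2%N * (v 0%N * w 1%N - v 1%N * w 0%N).
Definition det2 (u v : nat -> int) : int := u 0%N * v 1%N - u 1%N * v 0%N.

Definition ecrd (z : ZS4) (c : nat) : int := crd c z.
Definition ocrd (z : ZS4) (c : nat) : int := crd (3 + c) z.

Definition unitz (x : int) := x = 1 \/ x = - 1.

(* The determinants of three or two candidate elements reduce to the exponential expressions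
   below, which are excluded by congruences modulo 5, 19 and 27. *)
Definition pow236 (pw : int -> nat -> int) n : int := pw 2 n + pw 3 n + pw 2 n * pw 3 n.
Definition exp_even (pw : int -> nat -> int) k l : int := pw 2 k * (pow236 pw l + 7) + (- 1) *
  (pow236 pw k + pow236 pw l).
Definition exp_odd (pw : int -> nat -> int) k i : int :=
  2 * (1 + pw 2 k + pw 3 k) + - 1 * (pw 2 k * (3 * pw 2 i + 2 * pw 3 i + pw 2 i * pw 3 i)).
Definition exp_mixed (pw : int -> nat -> int) i j k : int :=
  pw 2 i + pw 2 j + pw 3 i + pw 3 j + pw 2 i * pw 3 j + pw 3 i * pw 2 j
  + - 1 * (pw 2 i * (3 * pw 2 k + 2 * pw 3 k + pw 2 k * pw 3 k)).

Lemma exp_even_mod M k l : (exp_even expz k l = exp_even (pow_mod M) k l %[mod M])%Z.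
Proof. rewrite /exp_even /pow236; eqmod. Qed.
Lemma exp_odd_mod M k l : (exp_odd expz k l = exp_odd (pow_mod M) k l %[mod M])%Z.
Proof. rewrite /exp_odd; eqmod. Qed.
Lemma exp_mixed_mod M i j k : (exp_mixed expz i j k = exp_mixed (pow_mod M) i j k %[mod M])%Z.
Proof. rewrite /exp_mixed; eqmod. Qed.

Lemma pow_mod5_period x n : x \in [:: 2; 3] -> pow_mod 5 x (n + 4) = pow_mod 5 x n.
Proof.
by rewrite !inE => /orP [/eqP -> | /eqP ->]; apply: (@pow_mod_period _ _ 0) => //; vm_compute.
Qed.

Lemma pow_mod19_27_period M x n : M \in [:: 19; 27] -> x \in [:: 2; 3] -> (4 <= n)%N ->
  pow_mod M x (n + 18) = pow_mod M x n.
Proof.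
rewrite !inE => /orP [] /eqP -> /orP [] /eqP -> n4; apply: (pow_mod_period _ n4); by vm_compute.
Qed.

(** Modulo 5 the powers of 2 and 3 have period 4, which respects parity, and these parities never
    give 2 or 3, the residues of 12 and -12. *)
Lemma exp_mixed_neq i j k : odd i -> ~~ odd j -> ~~ odd k ->
  exp_mixed expz i j k <> 12 /\ exp_mixed expz i j k <> - 12.
Proof.
have chk : [|| ~~ odd i, odd j, odd k | (exp_mixed (pow_mod 5) i j k %% 5)%Z \notin [:: 2; 3]].
  move: k; apply: (@periodic_all _ 0 4) => [//|k _|].
    by rewrite /exp_mixed !pow_mod5_period // oddD addbF.
  move: i j; apply: (@periodic_all2 _ 0 4) => [//|i j _|i j _|]; last by vm_compute.
    by apply: eq_all => k; rewrite /exp_mixed !pow_mod5_period // oddD addbF.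
  by apply: eq_all => k; rewrite /exp_mixed !pow_mod5_period // oddD addbF.
move=> oi /negPf oj /negPf ok; move: chk; rewrite oi oj ok /= -exp_mixed_mod.
by move=> h; split=> e; move: h; rewrite e.
Qed.

Lemma exp_even_neqN k l : ~~ odd k -> odd l -> exp_even expz k l <> - 12.
Proof.
have chk : [|| odd k, ~~ odd l | (exp_even (pow_mod 5) k l %% 5)%Z != 3].
  move: k l; apply: (@periodic_all2 _ 0 4) => [//|i j _|i j _|]; last by vm_compute.
    by rewrite /exp_even /pow236 !pow_mod5_period // oddD addbF.
  by rewrite /exp_even /pow236 !pow_mod5_period // oddD addbF.
by move=> /negPf ok ol; move: chk; rewrite ok ol /= -exp_even_mod => h e; move: h; rewrite e.
Qed.

Lemma exp_odd_neqN k l : odd k -> ~~ odd l -> exp_odd expz k l <> - 24.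
Proof.
have chk : [|| ~~ odd k, odd l | (exp_odd (pow_mod 5) k l %% 5)%Z != 1].
  move: k l; apply: (@periodic_all2 _ 0 4) => [//|i j _|i j _|]; last by vm_compute.
    by rewrite /exp_odd !pow_mod5_period // oddD addbF.
  by rewrite /exp_odd !pow_mod5_period // oddD addbF.
by move=> ok /negPf ol; move: chk; rewrite ok ol /= -exp_odd_mod => h e; move: h; rewrite e.
Qed.

(** The bound on [k] avoids the solution k = 2, l = 1. Its translate k = 20, l = 1 agrees with it
    modulo 19 but gives 3 instead of 12 modulo 27. *)
Lemma exp_even_neq k l : (4 <= k)%N -> ~~ odd k -> odd l -> exp_even expz k l <> 12.
Proof.
have chk : [|| k < 4, odd k, ~~ odd l, (exp_even (pow_mod 19) k l %% 19)%Z != 12 |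
    (exp_even (pow_mod 27) k l %% 27)%Z != 12]%N.
  move: k l; apply: (@periodic_all2 _ 4 18) => [//|k l n4|k l n4|]; last by vm_compute.
    have -> : (k + 18 < 4 = (k < 4))%N by lia.
    by rewrite /exp_even /pow236 !pow_mod19_27_period // oddD addbF.
  by rewrite /exp_even /pow236 !pow_mod19_27_period // oddD addbF.
rewrite leqNgt => /negPf k4 /negPf ok ol; move: chk; rewrite k4 ok ol /= -!exp_even_mod => h e.
by move: h; rewrite e.
Qed.

(** The bounds avoid the solution k = 3, i = 0, which is the pair m_3, m_1: the family (i,i,1)
    contains m_1 at i = 0. *)
Lemma exp_odd_neq k i : (5 <= k)%N -> odd k -> (2 <= i)%N -> ~~ odd i -> exp_odd expz k i <> 24.
Proof.
have chk : [|| k < 5, ~~ odd k, i < 2, odd i, (exp_odd (pow_mod 19) k i %% 19)%Z != 5 |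
    (exp_odd (pow_mod 27) k i %% 27)%Z != 24]%N.
  move: k i; apply: (@periodic_all2 _ 5 18) => [//|k i n4|k i n4|]; last by vm_compute.
    have -> : (k + 18 < 5 = (k < 5))%N by lia.
    by rewrite /exp_odd !pow_mod19_27_period // ?(ltnW n4) // oddD addbF.
  have -> : (i + 18 < 2 = (i < 2))%N by lia.
  by rewrite /exp_odd !pow_mod19_27_period // ?(ltnW n4) // oddD addbF.
rewrite leqNgt => /negPf k4 ok i2 /negPf oi; move: chk; rewrite k4 ok oi /= -!exp_odd_mod.
by rewrite ltnNge i2 => h e; move: h; rewrite e.
Qed.

(** * Determinants *)

Definition vals (s : seq nat) (c : nat) : int :=
  nth 0 [:: Msum s (1, 2, 3); Msum s (-1, 1, 2); Msum s (0, 1, -1)] c.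

(** The coefficients are central characters: class size times character value divided by degree. *)
Lemma vals_even s : size s = 3 -> ~~ odd (sumn s) -> let z := ecrd (tripZ s) in
  [/\ vals s 0 = z 0%N + 8 * z 1%N + 3 * z 2%N, vals s 1 = z 0%N - z 2%N
    & vals s 2 = z 0%N - 4 * z 1%N + 3 * z 2%N].
Proof.
move=> s3 /(tripZ_even s3); rewrite /vals /ecrd /=.
move: (Msum _ _) (Msum _ _) (Msum _ _) (crd _ _) (crd _ _) (crd _ _) (crd _ _) (crd _ _).
by move=> ? ? ? ? ? ? ? ? [*]; split; lia.
Qed.

Lemma vals_odd s : size s = 3 -> odd (sumn s) -> let z := ocrd (tripZ s) in
  vals s 0 = 6 * z 0%N + 6 * z 1%N /\ vals s 1 = 2 * z 0%N - 2 * z 1%N.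
Proof.
move=> s3 /(tripZ_odd s3); rewrite /vals /ocrd /=.
move: (Msum _ _) (Msum _ _) (crd _ _) (crd _ _) (crd _ _) (crd _ _) (crd _ _).
by move=> ? ? ? ? ? ? ? [*]; split; lia.
Qed.

(** The factor -48 is the determinant of the central characters in [vals_even]; -24 in [det2_vals]
    comes from [vals_odd] in the same way. *)
Lemma det3_vals s t u : size s = 3 -> size t = 3 -> size u = 3 ->
  ~~ odd (sumn s) -> ~~ odd (sumn t) -> ~~ odd (sumn u) ->
  det3 (vals s) (vals t) (vals u) =
  - 48 * det3 (ecrd (tripZ s)) (ecrd (tripZ t)) (ecrd (tripZ u)).
Proof.
move=> s3 t3 u3 es et eu; rewrite /det3.
have [-> -> ->] := vals_even s3 es; have [-> -> ->] := vals_even t3 et.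
have [-> -> ->] := vals_even u3 eu; ring.
Qed.

Lemma det2_vals s t : size s = 3 -> size t = 3 -> odd (sumn s) -> odd (sumn t) ->
  det2 (vals s) (vals t) = - 24 * det2 (ocrd (tripZ s)) (ocrd (tripZ t)).
Proof.
move=> s3 t3 os ot; rewrite /det2.
have [-> ->] := vals_odd s3 os; have [-> ->] := vals_odd t3 ot; ring.
Qed.

Lemma signz n : (-1) ^+ n = (if odd n then - 1 else 1) :> int.
Proof. by rewrite -signr_odd; case: odd. Qed.

Section Values.
Implicit Types i j k l : nat.

Lemma vals_ll0 l : (0 < l)%N ->
  [/\ vals [:: l; l; 0%N] 0 = pow236 expz l,
      vals [:: l; l; 0%N] 1 = if odd l then - 1 else 1 + 2 * 2 ^+ l
    & vals [:: l; l; 0%N] 2 = if odd l then - 1 else 1].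
Proof.
move=> l0; rewrite /vals /= !Msum_iik ?gtn_eqF //= /pow236 !expr1n !expr0 !expr0n !gtn_eqF //=
  signz.
by case: ifP => _; split; ring.
Qed.

Lemma vals_000 : [/\ vals [:: 0; 0; 0]%N 0 = 1, vals [:: 0; 0; 0]%N 1 = 1 & vals [:: 0; 0; 0]%N 2
  = 1].
Proof. by rewrite /vals /= !Msum_iii. Qed.

Lemma vals_222 : [/\ vals [:: 2; 2; 2]%N 0 = 36, vals [:: 2; 2; 2]%N 1 = 4 & vals [:: 2; 2; 2]%N
  2 = 0].
Proof. by rewrite /vals /= !Msum_iii. Qed.

Lemma vals_002 : [/\ vals [:: 0; 0; 2]%N 0 = 14, vals [:: 0; 0; 2]%N 1 = 6 & vals [:: 0; 0; 2]%N
  2 = 2].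
Proof. by rewrite /vals /= !Msum_iik. Qed.

Definition val_ii2 i : int := 9 * 2 ^+ i + 4 * 3 ^+ i + 2 ^+ i * 3 ^+ i.

Lemma vals_ii2 i : (0 < i)%N -> i != 2 ->
  [/\ vals [:: i; i; 2%N] 0 = val_ii2 i,
      vals [:: i; i; 2%N] 1 = if odd i then - 4 else 4 + 2 * 2 ^+ i
    & vals [:: i; i; 2%N] 2 = 0].
Proof.
move=> i0 i2; rewrite /vals /= !Msum_iik //= /val_ii2 !expr1n !expr0n !gtn_eqF //= signz.
by case: ifP => _; split; ring.
Qed.

Lemma vals_ii1 i : i != 1 ->
  vals [:: i; i; 1%N] 0 = 3 * 2 ^+ i + 2 * 3 ^+ i + 2 ^+ i * 3 ^+ i /\
  vals [:: i; i; 1%N] 1 = if odd i then - 2 - 2 * 2 ^+ i else 2.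
Proof.
move=> i1; rewrite /vals /= !Msum_iik //= !expr1n signz.
by case: ifP => _; split; ring.
Qed.

Lemma vals_111 : vals [:: 1; 1; 1]%N 0 = 6 /\ vals [:: 1; 1; 1]%N 1 = - 2.
Proof. by rewrite /vals /= !Msum_iii. Qed.

Lemma vals_00k k : odd k ->
  vals [:: 0; 0; k]%N 0 = 1 + 2 ^+ k + 3 ^+ k /\ vals [:: 0; 0; k]%N 1 = 2 ^+ k.
Proof.
move=> ok; rewrite /vals /= !Msum_iik; try by case: k ok.
rewrite /= !expr0 !expr1n signz ok; split; ring.
Qed.

Lemma vals_ij0 i j : odd i -> ~~ odd j -> (0 < j)%N ->
  vals [:: i; j; 0]%N 0 =
    2 ^+ i + 2 ^+ j + 3 ^+ i + 3 ^+ j + 2 ^+ i * 3 ^+ j + 3 ^+ i * 2 ^+ j /\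
  vals [:: i; j; 0]%N 1 = 2 * 2 ^+ i.
Proof.
move=> oi oj j0; have ij : i != j by apply: contraNneq oj => <-.
have i0 : i != 0%N by case: i oi {ij}.
rewrite /vals /= !Msum_ijk // -?lt0n //.
by rewrite /= !expr0 !expr1n !signz oi (negPf oj); split; ring.
Qed.
End Values.

(** * Determinants of even triples *)

Lemma pow_ge (x : int) m n : 1 <= x -> (m <= n)%N -> x ^+ m <= x ^+ n.
Proof. by move=> x1; exact: ler_weXn2l. Qed.

(** The bound is sharp: 8 + 27 + 216 = 251 is the value at l = 3. *)
Lemma pow236_lt251 l : odd l -> pow236 expz l < 251 -> l = 1%N.
Proof.
case: l => [|[|[|l]]] // _ e; exfalso.
have p2 : (2 : int) ^+ 3 <= 2 ^+ l.+3 by exact: pow_ge.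
have p3 : (3 : int) ^+ 3 <= 3 ^+ l.+3 by exact: pow_ge.
(* The product (2^l - 8)(3^l - 27) >= 0 bounds the mixed term 2^l 3^l linearly, as [lia]
   requires. *)
have := mulr_ge0 (etrans (subr_ge0 _ _) p2) (etrans (subr_ge0 _ _) p3).
by move: e p2 p3; rewrite /pow236 !(exprS _ 2) !expr2; lia.
Qed.

Lemma pow2_ge n : (4 <= n)%N -> 16 <= (2 : int) ^+ n.
Proof. by move=> n4; rewrite (_ : 16 = 2 ^+ 4) // pow_ge. Qed.
Lemma pow3_ge n : (4 <= n)%N -> 81 <= (3 : int) ^+ n.
Proof. by move=> n4; rewrite (_ : 81 = 3 ^+ 4) // pow_ge. Qed.

Lemma pow236_gt0 l : 0 < pow236 expz l.
Proof. by rewrite /pow236 !addr_gt0 ?mulr_gt0 ?exprn_gt0. Qed.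

Lemma pow2_even i : ~~ odd i -> exists w, (2 : int) ^+ i = 3 * w + 1.
Proof.
move=> /even_halfK <-; elim: i./2 => [|n [w e]]; first by exists 0.
by rewrite doubleS !exprS e; exists (4 * w + 1); ring.
Qed.

Lemma vals_ii2P i : [\/ [/\ i = 0%N, vals [:: i; i; 2%N] 0 = 14, vals [:: i; i; 2%N] 1 = 6 & vals
  [:: i; i; 2%N] 2 = 2],
   [/\ i = 2%N, vals [:: i; i; 2%N] 0 = 36, vals [:: i; i; 2%N] 1 = 4 & vals [:: i; i; 2%N] 2 = 0],
   [/\ odd i, vals [:: i; i; 2%N] 0 = val_ii2 i, vals [:: i; i; 2%N] 1 = - 4 & vals [:: i; i;
     2%N] 2 = 0]
 | [/\ ~~ odd i, (4 <= i)%N, vals [:: i; i; 2%N] 0 = val_ii2 i, vals [:: i; i; 2%N] 1 = 4 + 2 * 2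
   ^+ i
     & vals [:: i; i; 2%N] 2 = 0]].
Proof.
case: i => [|i]; first by have [] := vals_002; constructor 1.
have [->|i2] := eqVneq i.+1 2%N; first by have [] := vals_222; constructor 2.
have [] := @vals_ii2 i.+1 isT i2; case: ifP => oi e1 e2 e3; first by constructor 3.
constructor 4; split=> //.
by case: i i2 oi {e1 e2 e3} => [|[|[|i]]].
Qed.

(** The value rows (1, 1, 1) and (P, -1, -1), with P = [pow236 expz l], agree in their last two
    entries, so the determinant is 1 + P times the difference of the last two entries of the third
    row. This difference is 4 or -4, forcing P = 11, except for even i >= 4, where it is at least 36
    and the product exceeds 48. *)
Lemma unitz_000_ll0_ii2 l i : odd l ->
  unitz (det3 (ecrd (tripZ [:: 0; 0; 0]%N)) (ecrd (tripZ [:: l; l; 0]%N)) (ecrd (tripZ [:: i; i;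
    2]%N))) ->
  l = 1%N /\ [|| i == 0, i == 2 | odd i]%N.
Proof.
move=> ol h; have := @det3_vals [:: 0; 0; 0]%N [:: l; l; 0]%N [:: i; i; 2]%N.
rewrite /= !addn0 addnn odd_double addnA addnn oddD odd_double => /(_ erefl erefl erefl isT isT
  isT).
move: h; set d := det3 (ecrd _) _ _ => h.
rewrite /det3; have [-> -> ->] := vals_000.
have [-> ] := vals_ll0 (odd_gt0 ol); rewrite ol => -> ->.
have a0 := pow236_gt0 l.
case: (vals_ii2P i) => [[-> -> -> ->]|[-> -> -> ->]|[oi -> -> ->]|[oi i4 -> -> ->]].
- by move=> e; split=> //; apply: pow236_lt251 => //; move: e a0 h; rewrite /unitz; lia.
- by move=> e; split=> //; apply: pow236_lt251 => //; move: e a0 h; rewrite /unitz; lia.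
- by rewrite oi !orbT => e; split=> //; apply: pow236_lt251 => //; move: e a0 h; rewrite /unitz;
  lia.
- have w16 := pow2_ge i4; have := mulr_ge0 (etrans (subr_ge0 _ _) w16) (ltW a0).
  by move: a0 w16 h; rewrite /unitz; lia.
Qed.

Lemma pow236_2 : pow236 expz 2 = 49. Proof. by []. Qed.
Lemma sqr2 : (2 : int) ^+ 2 = 4. Proof. by []. Qed.

Lemma unitz_kk0_ll0_ii2 k l i : (0 < k)%N -> ~~ odd k -> odd l ->
  unitz (det3 (ecrd (tripZ [:: k; k; 0]%N)) (ecrd (tripZ [:: l; l; 0]%N)) (ecrd (tripZ [:: i; i;
    2]%N))) ->
  [/\ k = 2%N, l = 1%N & (i == 0%N) || (i == 2%N)].
Proof.
move=> k0 ok ol h; have := @det3_vals [:: k; k; 0]%N [:: l; l; 0]%N [:: i; i; 2]%N.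
rewrite /= !addn0 !addnn !odd_double addnA addnn oddD odd_double => /(_ erefl erefl erefl isT isT
  isT).
move: h; set d := det3 (ecrd _) _ _ => h.
rewrite /det3; have [-> ] := vals_ll0 k0; rewrite (negPf ok) => -> ->.
have [-> ] := vals_ll0 (odd_gt0 ol); rewrite ol => -> ->.
have a0 := pow236_gt0 l; have b0 := pow236_gt0 k.
have k24 : k = 2%N \/ (4 <= k)%N.
  by case: k k0 ok {h d b0} => [|[|[|[|k]]]] // _ _; [left | right].
case: (vals_ii2P i) => [[-> -> -> ->]|[-> -> -> ->]|[oi -> -> ->]|[oi i4 -> -> ->]].
(* For i = 0 the determinant is -4 [exp_even], so [exp_even] has to be 12 or -12. *)
- case: k24 => [-> | k4] e; last first.
    exfalso; case: h => hd; rewrite hd in e.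
      apply: (exp_even_neq k4 ok ol); move: e; rewrite /exp_even; lia.
    apply: (exp_even_neqN ok ol); move: e; rewrite /exp_even; lia.
  split=> //; apply: pow236_lt251 => //; move: e h; rewrite /unitz pow236_2 sqr2; lia.
(* For i = 2 the determinant is 4 (P_k + P_l) - 72 2^k; once 3^k >= 81, the term 2^k 3^k of P_k
   outweighs the negative part. *)
- case: k24 => [-> | k4] e; last first.
    exfalso; have x16 := pow2_ge k4; have y81 := pow3_ge k4.
    have := mulr_ge0 (etrans (subr_ge0 _ _) y81) (le_trans _ x16).
    by move=> /(_ isT); move: x16 y81 e a0 h; rewrite /unitz [pow236 _ k]/pow236; lia.
  split=> //; apply: pow236_lt251 => //; move: e a0 h; rewrite /unitz pow236_2 sqr2; lia.
(* For odd i all terms of the determinant are negative, and 4 P_k >= 196 is already too large. *)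
- move=> e; exfalso; have g0 : 0 < val_ii2 i by rewrite /val_ii2 !addr_gt0 ?mulr_gt0 ?exprn_gt0.
  have X0 : 0 < (2 : int) ^+ k by rewrite exprn_gt0.
  have b49 : 49 <= pow236 expz k.
    rewrite -pow236_2 /pow236; have p2 : (2 : int) ^+ 2 <= 2 ^+ k by apply: pow_ge => //; lia.
    have p3 : (3 : int) ^+ 2 <= 3 ^+ k by apply: pow_ge => //; lia.
    by rewrite !lerD // ler_pM.
  have xg := mulr_gt0 X0 g0.
  have : 4 * pow236 expz k + 4 * pow236 expz l + 2 * (2 ^+ k * val_ii2 i) = 48 * d by rewrite
    -[LHS]opprK; apply: (canLR (@opprK _)); rewrite -mulNr -e; ring.
  move: xg a0 b49 h; rewrite /unitz; move: (2 ^+ k * val_ii2 i) (pow236 _ k) (pow236 _ l) (d);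
    clear.
  by move=> x y z t; lia.
(* For even i >= 4 the determinant is (P_k + P_l)(4 + 2 2^i) - 2 2^k [val_ii2 i]. Since 2^k and 2^i
   are 1 and 2^l is 2 modulo 3, both factors of the first product are divisible by 3; [val_ii2 i] is
   divisible by 9. But 9 does not divide 48. *)
- move=> e; exfalso.
  have [x Ex] := pow2_even ok; have [w Ew] := pow2_even oi.
  have [u Eu] : exists u, (2 : int) ^+ l = 3 * u + 2.
    case: l ol {h e a0 d} => // l /pow2_even [u Eu].
    by rewrite exprS Eu; exists (2 * u); ring.
  have Ey : (3 : int) ^+ k = 3 * 3 ^+ k.-1 by rewrite -exprS prednK.
  have Ev : (3 : int) ^+ l = 3 * 3 ^+ l.-1 by rewrite -exprS prednK ?odd_gt0.
  have Ez : (3 : int) ^+ i = 3 * (3 * 3 ^+ (i - 2)).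
    by rewrite -!exprS; congr (_ ^+ _); move: i4; clear; lia.
  set y := 3 ^+ k.-1 in Ey; set v := 3 ^+ l.-1 in Ev; set z := 3 ^+ (i - 2) in Ez.
  have e' : 9 * ((w + 1) * 2 * (x + u + y + v + 1 + (3 * x + 1) * y + (3 * u + 2) * v)
      - (3 * x + 1) * 2 * (3 * w + 1 + 4 * z + (3 * w + 1) * z)) = - 48 * d.
    by rewrite -e /pow236 /val_ii2 Ex Ew Eu Ey Ev Ez; ring.
  move: e' h; rewrite /unitz; move: (_ - _) => m; lia.
Qed.

(** The constant 5 is what n = 4 allows: 80 <= 81. *)
Lemma pow32 n : (4 <= n)%N -> 5 * (2 : int) ^+ n <= 3 ^+ n.
Proof.
move=> /subnK <-; elim: (n - 4)%N => //= m IH.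
rewrite addSn !exprS; have : 0 < (2 : int) ^+ (m + 4) by rewrite exprn_gt0.
lia.
Qed.

(** * Determinants of odd pairs *)

Section OddPairs.
Implicit Types i j k : nat.
Local Notation od s t := (det2 (ocrd (tripZ s)) (ocrd (tripZ t))).

(** The equation is 3^k + 1 = 2 2^k + 12 d with d = 1 or -1. It holds at k = 3 with d = 1; from k =
    4 on, [pow32] makes the left side too large. *)
Lemma unitz_001_00k k : odd k -> unitz (od [:: 0; 0; 1]%N [:: 0; 0; k]) -> k = 3%N.
Proof.
move=> ok h; have := @det2_vals [:: 0; 0; 1]%N [:: 0; 0; k].
rewrite /= addn0 => /(_ erefl erefl isT ok); move: h; set d := det2 (ocrd _) _; move: d => d h.
rewrite /det2; have [-> ->] := @vals_00k 1 isT; have [-> ->] := vals_00k ok.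
case: k ok => [|[|[|[|k]]]] //= ok.
  by rewrite !expr1; move: h; rewrite /unitz; lia.
have := @pow32 k.+4 isT; have := @pow2_ge k.+4 isT; move: h; rewrite /unitz !expr1; lia.
Qed.

(** With S the value at the contents (1,2,3), the equation is S = 6 2^i + 12 d. The term 2^i 3^j of
    S is at least 9 2^i, and the other terms exceed 12. *)
Lemma nunitz_001_ij0 i j : odd i -> ~~ odd j -> (0 < j)%N -> ~ unitz (od [:: 0; 0; 1]%N [:: i; j;
  0]%N).
Proof.
move=> oi oj j0 h; have := @det2_vals [:: 0; 0; 1]%N [:: i; j; 0]%N.
rewrite /= !addn0 oddD oi (negPf oj) => /(_ erefl erefl isT isT).
move: h; set d := det2 (ocrd _) _ => h.
rewrite /det2; have [-> ->] := @vals_00k 1 isT; have [-> ->] := vals_ij0 oi oj j0.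
have j2 : (2 <= j)%N by case: j j0 oj {h d} => [|[]].
have p2 : (2 : int) ^+ 2 <= 2 ^+ j by exact: pow_ge.
have p3 : (3 : int) ^+ 2 <= 3 ^+ j by exact: pow_ge.
have q2 : (2 : int) ^+ 1 <= 2 ^+ i by apply: pow_ge => //; exact: odd_gt0.
have q3 : (3 : int) ^+ 1 <= 3 ^+ i by apply: pow_ge => //; exact: odd_gt0.
have m1 := mulr_ge0 (etrans (subr_ge0 _ _) p3) (le_trans _ q2).
have m2 : 0 < (3 : int) ^+ i * 2 ^+ j by rewrite mulr_gt0 ?exprn_gt0.
by move: (m1 isT) p2 p3 q2 q3 h m2; rewrite /unitz !expr1 !(expr2 2) !(expr2 3); lia.
Qed.

Lemma vals_ii1P i : i = 1%N /\ vals [:: i; i; 1%N] 0 = 6 /\ vals [:: i; i; 1%N] 1 = - 2 \/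
  i != 1%N /\ vals [:: i; i; 1%N] 0 = 3 * 2 ^+ i + 2 * 3 ^+ i + 2 ^+ i * 3 ^+ i /\
  vals [:: i; i; 1%N] 1 = if odd i then - 2 - 2 * 2 ^+ i else 2.
Proof.
have [->|i1] := eqVneq i 1%N; first by left; have [] := vals_111.
by right; have [] := vals_ii1 i1.
Qed.

Lemma unitz_001_ii1 i : (0 < i)%N -> unitz (od [:: 0; 0; 1]%N [:: i; i; 1]%N) -> i = 1%N.
Proof.
move=> i0 h; have := @det2_vals [:: 0; 0; 1]%N [:: i; i; 1]%N.
rewrite /= addnA addnn oddD odd_double => /(_ erefl erefl isT isT).
move: h; set d := det2 (ocrd _) _ => h.
rewrite /det2; have [-> ->] := @vals_00k 1 isT.
case: (vals_ii1P i) => [[-> //]|[i1 [-> ->]]] e; exfalso.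
have p2 : (2 : int) ^+ 2 <= 2 ^+ i by apply: pow_ge => //; lia.
have p3 : (3 : int) ^+ 2 <= 3 ^+ i by apply: pow_ge => //; lia.
have m : 0 < (2 : int) ^+ i * 3 ^+ i by rewrite mulr_gt0 ?exprn_gt0.
by move: e h p2 p3 m; rewrite /unitz !expr1 !(expr2 2) !(expr2 3); case: ifP => _; lia.
Qed.

Lemma nunitz_00k_ii1 k i : odd k -> k != 1%N -> (0 < i)%N -> ~ unitz (od [:: 0; 0; k]%N [:: i; i;
  1]%N).
Proof.
move=> ok k1 i0 h; have := @det2_vals [:: 0; 0; k]%N [:: i; i; 1]%N.
have oi1 : odd (i + (i + 1)) by rewrite addnA addnn oddD odd_double.
rewrite /= !addn0 => /(_ erefl erefl ok oi1).
move: h; set d := det2 (ocrd _) _ => h.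
rewrite /det2; have [-> ->] := vals_00k ok.
have k3 : (3 <= k)%N by case: k ok k1 {d h} => [|[|[]]].
have r2 : (2 : int) ^+ 3 <= 2 ^+ k by exact: pow_ge.
have r3 : (3 : int) ^+ 3 <= 3 ^+ k by exact: pow_ge.
case: (vals_ii1P i) => [[_ [-> ->]]|[i1 [-> ->]]] e.
  by move: e h r2 r3; rewrite /unitz !exprS !expr0; lia.
have p2 : (2 : int) ^+ 2 <= 2 ^+ i by apply: pow_ge => //; lia.
have p3 : (3 : int) ^+ 2 <= 3 ^+ i by apply: pow_ge => //; lia.
have m : 0 < (2 : int) ^+ i * 3 ^+ i by rewrite mulr_gt0 ?exprn_gt0.
case oi: (odd i) e => e.
  (* For odd i the value -2 - 2 2^i is negative, so both products in the determinant push it the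
     same way. *)
  have m1 : 0 < (1 + 2 ^+ k + 3 ^+ k : int) * 2 ^+ i by rewrite mulr_gt0 ?addr_gt0 ?exprn_gt0.
  have m2 : 0 < (3 * 2 ^+ i + 2 * 3 ^+ i + 2 ^+ i * 3 ^+ i : int) * 2 ^+ k.
    by rewrite mulr_gt0 ?addr_gt0 ?mulr_gt0 ?exprn_gt0.
  by move: e h m1 m2 r2 r3; rewrite /unitz [in _ <= _]exprS !(exprS _ 2) !expr2; lia.
(* For even i the determinant is [exp_odd]; congruences settle k >= 5, and size settles k = 3. *)
have [k5|k5] := leqP 5 k.
  have i2 : (2 <= i)%N by lia.
  case: h => hd; rewrite hd in e.
    by apply: (exp_odd_neqN ok (negbT oi)); move: e; rewrite /exp_odd; lia.
  by apply: (exp_odd_neq k5 ok i2 (negbT oi)); move: e; rewrite /exp_odd; lia.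
have k3' : k = 3%N by case: k ok k1 k3 k5 {e h d r2 r3} => [|[|[|[|[|]]]]].
by subst k; move: e h p2 p3 m; rewrite /unitz (_ : 2 ^+ 3 = 8) // (_ : 3 ^+ 3 = 27) // !expr2; lia.
Qed.

Lemma nunitz_ij0_ii1 i j k : odd i -> ~~ odd j -> (0 < j)%N -> (0 < k)%N ->
  ~ unitz (od [:: i; j; 0]%N [:: k; k; 1]%N).
Proof.
move=> oi oj j0 k0 h; have := @det2_vals [:: i; j; 0]%N [:: k; k; 1]%N.
have ok1 : odd (k + (k + 1)) by rewrite addnA addnn oddD odd_double.
have oij : odd (i + j) by rewrite oddD oi (negPf oj).
rewrite /= !addn0 => /(_ erefl erefl oij ok1).
move: h; set d := det2 (ocrd _) _ => h.
rewrite /det2; have [-> ->] := vals_ij0 oi oj j0.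
have j2 : (2 <= j)%N by case: j j0 oj {h d oij} => [|[]].
have p2 : (2 : int) ^+ 2 <= 2 ^+ j by exact: pow_ge.
have p3 : (3 : int) ^+ 2 <= 3 ^+ j by exact: pow_ge.
have q2 : (2 : int) ^+ 1 <= 2 ^+ i by apply: pow_ge => //; exact: odd_gt0.
have q3 : (3 : int) ^+ 1 <= 3 ^+ i by apply: pow_ge => //; exact: odd_gt0.
have m1 : 0 < (2 : int) ^+ i * 3 ^+ j by rewrite mulr_gt0 ?exprn_gt0.
have m2 : 0 < (3 : int) ^+ i * 2 ^+ j by rewrite mulr_gt0 ?exprn_gt0.
case: (vals_ii1P k) => [[_ [-> ->]]|[k1 [-> ->]]] e.
  by move: e h p2 p3 q2 q3 m1 m2; rewrite /unitz !expr1 !(expr2 2) !(expr2 3); lia.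
case ok: (odd k) e => e.
  have m3 : 0 < (2 ^+ i + 2 ^+ j + 3 ^+ i + 3 ^+ j + 2 ^+ i * 3 ^+ j + 3 ^+ i * 2 ^+ j : int) * 2
    ^+ k.
    by rewrite mulr_gt0 ?addr_gt0 ?mulr_gt0 ?exprn_gt0.
  have m4 : 0 < (3 * 2 ^+ k + 2 * 3 ^+ k + 2 ^+ k * 3 ^+ k : int) * 2 ^+ i.
    by rewrite mulr_gt0 ?addr_gt0 ?mulr_gt0 ?exprn_gt0.
  by move: e h p2 p3 q2 q3 m1 m2 m3 m4; rewrite /unitz !expr1 !(expr2 2) !(expr2 3); lia.
(* For even k the determinant is 2 [exp_mixed], which would have to be 24 or -24. *)
have [h1 h2] := exp_mixed_neq oi oj (negbT ok).
case: h => hd; rewrite hd in e.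
  by apply: h2; move: e; rewrite /exp_mixed; lia.
by apply: h1; move: e; rewrite /exp_mixed; lia.
Qed.
End OddPairs.

(** * Families modulo 2 *)

Lemma epar_ll0 l :
  epar (tripZ [:: l; l; 0%N]) = if odd l then (false, true, true) else (true, false, false).
Proof.
rewrite epar_tripZ //; last by rewrite /= !addn0 addnn odd_double.
have [->|l0] := eqVneq l 0%N.
  by rewrite (@trip_res_eq _ (sym_iii expz 0)) => [|t]; last by rewrite Msum_iii.
rewrite (@trip_res_eq _ (sym_iik (pow_mod 8) l 0)) => [|t]; last by rewrite Msum_iik // sym_iik_mod.
by have /and4P [_ /eqP -> _ _] := sym_iik_kind l.
Qed.

Lemma epar_ii2 i : epar (tripZ [:: i; i; 2%N]) = (false, true, false).
Proof.
rewrite epar_tripZ //; last by rewrite /= ?addn0 addnA addnn oddD odd_double.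
have [->|i2] := eqVneq i 2%N.
  by rewrite (@trip_res_eq _ (sym_iii expz 2)) => [|t]; last by rewrite Msum_iii.
rewrite (@trip_res_eq _ (sym_iik (pow_mod 8) i 2)) => [|t]; last by rewrite Msum_iik // sym_iik_mod.
by have /and4P [/eqP -> _ _ _] := sym_iik_kind i.
Qed.

Lemma opar_ii1 i :
  opar (tripZ [:: i; i; 1%N]) = if i == 0%N then (true, false) else (false, true).
Proof.
rewrite opar_tripZ //; last by rewrite /= ?addn0 addnA addnn oddD odd_double.
have [->|i1] := eqVneq i 1%N.
  by rewrite (@trip_res_eq _ (sym_iii expz 1)) => [|t]; last by rewrite Msum_iii.
rewrite (@trip_res_eq _ (sym_iik (pow_mod 8) i 1)) => [|t]; last by rewrite Msum_iik // sym_iik_mod.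
by have /and4P [_ _ /eqP -> _] := sym_iik_kind i.
Qed.

Lemma opar_00k k : odd k -> k != 1%N -> opar (tripZ [:: 0%N; 0%N; k]) = (true, true).
Proof.
move=> ok k1; rewrite opar_tripZ //; last by rewrite /= !addn0.
have k0 : 0%N != k by case: k ok {k1}.
rewrite (@trip_res_eq _ (sym_iik (pow_mod 8) 0 k)) => [|t]; last by rewrite Msum_iik // sym_iik_mod.
by have /and4P [_ _ _] := sym_iik_kind k; rewrite ok (negPf k1) => /eqP.
Qed.

Lemma opar_ij0 i j : odd i -> ~~ odd j -> (0 < j)%N ->
  opar (tripZ [:: i; j; 0%N]) = (true, true).
Proof.
move=> oi oj j0; rewrite opar_tripZ //; last by rewrite /= !addn0 oddD oi (negPf oj).
have ij : i != j by apply: contraNneq oj => <-.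
have i0 : i != 0%N by case: i oi {ij}.
rewrite (@trip_res_eq _ (sym_ijk (pow_mod 8) i j 0)) => [|t]; last by rewrite Msum_ijk
  ?sym_ijk_mod // -lt0n.
by have := sym_ijk_kind i j; rewrite oi oj (negPf i0) gtn_eqF // => /eqP.
Qed.

(* Modulo 2 every even m_mu is zero or falls into one of three families, and a basis needs one
   member of each; similarly for the odd ones. *)
Definition ekind (z : ZS4) : Prop :=
  [\/ exists2 k, ~~ odd k & z = tripZ [:: k; k; 0%N],
      exists2 l, odd l & z = tripZ [:: l; l; 0%N],
      exists i, z = tripZ [:: i; i; 2%N]
    | epar z = (false, false, false)].

Definition okind (z : ZS4) : Prop :=
  z = tripZ [:: 0%N; 0%N; 1%N] \/
  [\/ exists k, [/\ odd k, k != 1%N & z = tripZ [:: 0%N; 0%N; k]],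
      exists i j, [/\ odd i, ~~ odd j, (0 < j)%N & z = tripZ [:: i; j; 0%N]],
      exists2 i, (0 < i)%N & z = tripZ [:: i; i; 1%N]
    | opar z = (false, false)].

Lemma tripZ_rot i j k : tripZ [:: i; j; k] = tripZ [:: j; k; i].
Proof. by apply: tripZ_perm; apply/permPl; exact: (perm_catC [:: i] [:: j; k]). Qed.

Lemma ekindP i j k : (j <= i)%N -> (k <= j)%N -> ~~ odd (i + (j + k)) -> ekind (tripZ [:: i; j; k]).
Proof.
move=> ji kj es.
have E : epar (tripZ [:: i; j; k]) = even_par (trip_res (Msum [:: i; j; k])).
  by rewrite epar_tripZ //= ?addn0 -?addnA.
have [eij|ij] := eqVneq i j.
  subst j; have ok : ~~ odd k by move: es; rewrite addnA addnn oddD odd_double.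
  have [->|k0] := eqVneq k 0%N.
    by case oi: (odd i); [constructor 2; exists i | constructor 1; exists i; rewrite ?oi].
  have [->|k2] := eqVneq k 2%N; first by constructor 3; exists i.
  constructor 4; rewrite E; apply/eqP; have [eik|ik] := eqVneq i k.
    subst k; rewrite (@trip_res_eq _ (sym_iii (pow_mod 8) i)) => [|t]; last by rewrite Msum_iii
      sym_iii_mod.
    by have := sym_iii_parity i; rewrite (negPf ok) (negPf k0) (negPf k2).
  rewrite (@trip_res_eq _ (sym_iik (pow_mod 8) i k)) => [|t]; last by rewrite Msum_iik //
    sym_iik_mod.
  have := sym_iik_parity i k; rewrite (negPf ok) (negPf k0) (negPf k2) (negPf ik) andbF //.
have [ejk|jk] := eqVneq j k.
  subst k; rewrite tripZ_rot in E *.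
  have oi : ~~ odd i by move: es; rewrite addnn oddD odd_double addbF.
  have [->|i2] := eqVneq i 2%N; first by constructor 3; exists j.
  have i0 : i != 0%N by apply: contraNneq ij => i0; move: ji; rewrite i0 leqn0 => /eqP ->.
  constructor 4; rewrite E; apply/eqP.
  have e : perm_eq [:: i; j; j] [:: j; j; i].
    by apply/permPl; exact: (perm_catC [:: i] [:: j; j]).
  rewrite (@trip_res_eq _ (sym_iik (pow_mod 8) j i)) => [|t].
    by have := sym_iik_parity j i; rewrite (negPf oi) (negPf i0) (negPf i2) eq_sym (negPf ij) andbF.
  by rewrite (Msum_perm _ e) Msum_iik 1?eq_sym // sym_iik_mod.
constructor 4; rewrite E; apply/eqP.
have ik : i != k by apply: contraNneq ij => ik; move: ji; rewrite ik => jk'; rewrite eqn_leq jk' kj.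
rewrite (@trip_res_eq _ (sym_ijk (pow_mod 8) i j k)) => [|t]; last by rewrite Msum_ijk //
  sym_ijk_mod.
by have := sym_ijk_parity i j k; rewrite -addnA (negPf es) (negPf ij) (negPf ik) (negPf jk) !andbF.
Qed.

Lemma okindP i j k : (j <= i)%N -> (k <= j)%N -> odd (i + (j + k)) -> okind (tripZ [:: i; j; k]).
Proof.
move=> ji kj os.
have E : opar (tripZ [:: i; j; k]) = odd_par (trip_res (Msum [:: i; j; k])).
  by rewrite opar_tripZ //= ?addn0 -?addnA.
have [eij|ij] := eqVneq i j.
  subst j; have ok : odd k by move: os; rewrite addnA addnn oddD odd_double.
  have [e1|k1] := eqVneq k 1%N.
    by right; constructor 3; exists i; rewrite ?e1 //; move: kj; rewrite e1.
  right; constructor 4; rewrite E; apply/eqP; have [eik|ik] := eqVneq i k.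
    subst k; rewrite (@trip_res_eq _ (sym_iii (pow_mod 8) i)) => [|t]; last by rewrite Msum_iii
      sym_iii_mod.
    by have := sym_iii_parity i; rewrite ok (negPf k1).
  rewrite (@trip_res_eq _ (sym_iik (pow_mod 8) i k)) => [|t]; last by rewrite Msum_iik //
    sym_iik_mod.
  have i0 : i != 0%N by case: i ji kj {E os ik} => //; case: k ok {k1}.
  by have := sym_iik_parity i k; rewrite ok (negPf k1) (negPf ik) (negPf i0) andbF.
have [ejk|jk] := eqVneq j k.
  subst k; rewrite tripZ_rot in E *.
  have oi : odd i by move: os; rewrite addnn oddD odd_double addbF.
  have [e0|j0] := eqVneq j 0%N.
    by have [->|i1] := eqVneq i 1%N; [left | right; constructor 1; exists i]; rewrite e0.
  have [->|i1] := eqVneq i 1%N; first by right; constructor 3; exists j; rewrite ?lt0n.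
  right; constructor 4; rewrite E; apply/eqP.
  have e : perm_eq [:: i; j; j] [:: j; j; i].
    by apply/permPl; exact: (perm_catC [:: i] [:: j; j]).
  rewrite (@trip_res_eq _ (sym_iik (pow_mod 8) j i)) => [|t].
    by have := sym_iik_parity j i; rewrite oi (negPf j0) (negPf i1) eq_sym (negPf ij) andbF.
  by rewrite (Msum_perm _ e) Msum_iik 1?eq_sym // sym_iik_mod.
have ik : i != k by apply: contraNneq ij => ik; move: ji; rewrite ik => jk'; rewrite eqn_leq jk' kj.
have j0 : (0 < j)%N by rewrite lt0n; apply: contraNneq jk => j0; move: kj; rewrite j0 leqn0 eq_sym.
have [k0|k0] := eqVneq k 0%N.
  subst k; right; constructor 2; move: os; rewrite addn0 oddD; case oi: (odd i) => /= oj.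
    by exists i, j; rewrite oi.
  exists j, i; rewrite oi; split=> //; first exact: leq_trans ji.
  by apply: tripZ_perm; apply/permPl; exact: (perm_catCA [:: i] [:: j] [:: 0%N]).
right; constructor 4; rewrite E; apply/eqP.
rewrite (@trip_res_eq _ (sym_ijk (pow_mod 8) i j k)) => [|t]; last by rewrite Msum_ijk //
  sym_ijk_mod.
have := sym_ijk_parity i j k; rewrite -addnA os (negPf ij) (negPf ik) (negPf jk) !andbF /=.
by rewrite (gtn_eqF j0) (gtn_eqF (leq_trans j0 ji)) (negPf k0).
Qed.

(** * Bases of the centre and determinants *)

Lemma crd_sum (s : seq ZS4) (e : ZS4 -> int) c :
  crd c (\sum_(b <- s) b *~ e b) = \sum_(b <- s) crd c b * e b.
Proof. by rewrite /crd sum_ffunE; apply: eq_bigr => b _; rewrite mulrz_ffunE. Qed.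

Lemma class_fun_sum (s : seq ZS4) (e : ZS4 -> int) :
  (forall b, b \in s -> class_fun b) -> class_fun (\sum_(b <- s) b *~ e b).
Proof.
move=> cf g; rewrite !sum_ffunE; apply: eq_big_seq => b bs.
by rewrite !mulrz_ffunE cf.
Qed.

Lemma class_fun_ext z z' : class_fun z -> class_fun z' ->
  (forall c, (c < 5)%N -> crd c z = crd c z') -> z = z'.
Proof. by move=> cz cz' e; apply/ffunP => g; rewrite cz cz' [LHS]e ?cls_lt. Qed.

Definition class_ind (c : nat) : ZS4 := [ffun g => ((cls (code g) == c) : nat)%:Z].

Lemma crd_class_ind c c' : (c < 5)%N -> crd c (class_ind c') = ((c == c') : nat)%:Z.
Proof.
move=> c5; rewrite /crd ffunE code_rperm //; congr (nat_of_bool (_ == _))%:Z.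
by case: c c5 => [|[|[|[|[|]]]]].
Qed.

Lemma class_fun_class_ind c : class_fun (class_ind c).
Proof.
move=> g; rewrite -[RHS]/(crd _ _) crd_class_ind ?cls_lt // ffunE //.
Qed.

Lemma sum_subset (s S : seq ZS4) (e : ZS4 -> int) : uniq S -> {subset s <= S} ->
  exists e', \sum_(b <- s) b *~ e b = \sum_(b <- S) b *~ e' b.
Proof.
move=> uS; elim: s => [|a s IH] sub.
  by exists (fun=> 0); rewrite big_nil big1 // => b _; rewrite mulr0z.
have [|e' E] := IH; first by move=> b bs; apply: sub; rewrite inE bs orbT.
exists (fun b => (if b == a then e a else 0) + e' b); rewrite big_cons E.
under [RHS]eq_bigr => b _ do rewrite mulrzDr.
rewrite big_split /=; congr (_ + _).
rewrite (bigD1_seq a) //= ?eqxx; last by apply: sub; exact: mem_head.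
by rewrite big1 ?addr0 // => b /negPf ->; rewrite mulr0z.
Qed.

Lemma unitzM x y : x * y = 1 -> unitz x.
Proof.
move=> e; have /eqP := congr1 absz e; rewrite abszM muln_eq1 => /andP [/eqP h _].
by rewrite /unitz; lia.
Qed.

Lemma det_mx3 (A : 'M[int]_3) (f : nat -> nat -> int) : (forall i j, A i j = f i j) ->
  \det A = det3 (f 0%N) (f 1%N) (f 2%N).
Proof.
move=> Af; rewrite (expand_det_row _ ord0) !big_ord_recl big_ord0 /cofactor.
rewrite !(expand_det_row _ ord0) !big_ord_recl !big_ord0 /cofactor !det_mx11 !mxE !Af /=.
by rewrite /bump /= /det3 !expr0 !expr1 !exprS !expr0; ring.
Qed.

Lemma det_mx2 (A : 'M[int]_2) (f : nat -> nat -> int) : (forall i j, A i j = f i j) ->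
  \det A = det2 (f 0%N) (f 1%N).
Proof.
move=> Af; rewrite (expand_det_row _ ord0) !big_ord_recl !big_ord0 /cofactor.
by rewrite !det_mx11 !mxE !Af /= /det2 !expr0 !expr1; ring.
Qed.

(* A family [s] on which the coordinates [f] form both a generating and an independent system
   is a square invertible matrix. *)
Lemma square_family d (s : seq ZS4) (f : ZS4 -> nat -> int) : uniq s ->
  (forall c, (c < d)%N -> exists e : ZS4 -> int,
     forall c', (c' < d)%N -> \sum_(b <- s) f b c' * e b = ((c' == c) : nat)%:Z) ->
  (forall e : ZS4 -> int, (forall c, (c < d)%N -> \sum_(b <- s) f b c * e b = 0) ->
     forall b, b \in s -> e b = 0) ->
  size s = d /\ exists P : 'M[int]_(size s, d),
    P *m (\matrix_(i < d, j < size s) f (nth 0 s j) i) = 1%:M.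
Proof.
move=> us span free; set A := \matrix_(i, j) _.
have [P AP] : exists P : 'M[int]_(size s, d), A *m P = 1%:M.
  have /fin_all_exists [e E] (c : 'I_d) := span c (ltn_ord c).
  exists (\matrix_(j, c) e c (nth 0 s j)); apply/matrixP => i c; rewrite !mxE.
  under eq_bigr => j _ do rewrite !mxE.
  by rewrite -(big_mkord xpredT (fun j => f (nth 0 s j) i * e c (nth 0 s j))) -(big_nth 0 xpredT
    (fun b => f b i * e c b)) E // -val_eqE natz.
have cancelA (v : 'cV[int]_(size s)) : A *m v = 0 -> v = 0.
  move=> Av; apply/colP => j; rewrite mxE.
  (* The vector v read as a function on the elements of s, with value 0 elsewhere. *)
  pose e (b : ZS4) := if insub (index b s) is Some i then v i 0 else 0.
  have eE (i : 'I_(size s)) : e (nth 0 s i) = v i 0.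
    by rewrite /e index_uniq // valK.
  rewrite -eE; apply: free; last exact: mem_nth.
  move=> c cd; have /colP /(_ (Ordinal cd)) := Av; rewrite !mxE => E0; rewrite -[RHS]E0.
  rewrite (big_nth 0) big_mkord; apply: eq_bigr => i _.
  by rewrite mxE eE.
(* Since A P = 1, the columns of P A - 1 are killed by A, hence zero; a two-sided inverse then
   forces the matrix to be square. *)
have PA : P *m A = 1%:M.
  apply/eqP; rewrite -subr_eq0; apply/eqP/matrixP => i j; rewrite [RHS]mxE.
  have -> : (P *m A - 1%:M) i j = col j (P *m A - 1%:M) i 0 by rewrite [RHS]mxE.
  rewrite (_ : col j _ = 0) ?mxE //; apply: cancelA.
  by rewrite colE mulmxA mulmxBr mulmxA AP mul1mx mulmx1 subrr mul0mx.
have := mulmx1_min PA; have := mulmx1_min AP => h1 h2.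
by split; [apply/eqP; rewrite eqn_leq h1 h2 | exists P].
Qed.

Lemma square_family3 (s : seq ZS4) (f : ZS4 -> nat -> int) (P : 'M[int]_(size s, 3)) :
  size s = 3 -> P *m (\matrix_(i < 3, j < size s) f (nth 0 s j) i) = 1%:M ->
  exists u v w, s = [:: u; v; w] /\ unitz (det3 (f u) (f v) (f w)).
Proof.
case: s P => [|u [|v [|w [|//]]]] //= P _ /(congr1 determinant); rewrite det_mulmx det1 mulrC => e.
exists u, v, w; split=> //.
rewrite -[det3 _ _ _](@det_mx3 (\matrix_(i < 3, j < 3) f (nth 0 [:: u; v; w] i) j) (fun i => f
  (nth 0 [:: u; v; w] i))) => [|i j]; last by rewrite mxE.
rewrite -det_tr; apply: (@unitzM _ (\det P)).
by rewrite -[RHS]e; congr (\det _ * _); apply/matrixP => i j; rewrite !mxE.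
Qed.

Lemma square_family2 (s : seq ZS4) (f : ZS4 -> nat -> int) (P : 'M[int]_(size s, 2)) :
  size s = 2 -> P *m (\matrix_(i < 2, j < size s) f (nth 0 s j) i) = 1%:M ->
  exists u v, s = [:: u; v] /\ unitz (det2 (f u) (f v)).
Proof.
case: s P => [|u [|v [|//]]] //= P _ /(congr1 determinant); rewrite det_mulmx det1 mulrC => e.
exists u, v; split=> //.
rewrite -[det2 _ _](@det_mx2 (\matrix_(i < 2, j < 2) f (nth 0 [:: u; v] i) j) (fun i => f (nth 0
  [:: u; v] i))) => [|i j]; last by rewrite mxE.
rewrite -det_tr; apply: (@unitzM _ (\det P)).
by rewrite -[RHS]e; congr (\det _ * _); apply/matrixP => i j; rewrite !mxE.
Qed.

(** * From a basis to unit determinants *)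

Definition even_elt (z : ZS4) := (crd 3 z == 0) && (crd 4 z == 0).
Definition odd_elt (z : ZS4) := [&& crd 0 z == 0, crd 1 z == 0 & crd 2 z == 0].

Section ForwardBasis.
Variables (B : ZS4 -> Prop).
Hypothesis Bcf : forall b, B b -> class_fun b.
Hypothesis Bhom : forall b, B b -> even_elt b || odd_elt b.
Hypothesis Bbasis : is_Zbasis_of_centre B.

Lemma basis_neq0 b : B b -> b != 0.
Proof.
move=> Bb; apply/eqP => b0.
have := Bbasis.1 [:: b] (fun=> 1) isT; rewrite big_seq1 b0 mul0rz.
have h x : x \in [:: b] -> B x by rewrite inE => /eqP ->.
by rewrite -b0 => /(_ h erefl b (mem_head _ _)).
Qed.

(** An element both even and odd has all five coordinates 0, and a basis element is nonzero. *)
Lemma odd_eltE b : B b -> odd_elt b = ~~ even_elt b.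
Proof.
move=> Bb; have := Bhom Bb; case: (boolP (even_elt b)) => //= /andP [/eqP e3 /eqP e4] _.
apply: contraTF (basis_neq0 Bb) => /and3P [/eqP e0 /eqP e1 /eqP e2]; rewrite negbK.
apply/eqP/class_fun_ext; [exact: Bcf | by move=> g; rewrite !ffunE |].
by case=> [|[|[|[|[|]]]]] // _; rewrite ?e0 ?e1 ?e2 ?e3 ?e4 /crd ffunE.
Qed.

Definition spanning (S : seq ZS4) := forall c, (c < 5)%N -> exists e, class_ind c = \sum_(b <- S)
  b *~ e b.

(** [B] is only a predicate and could be infinite; finitely many of its members already express the
    five class sums. *)
Lemma spanning_exists : exists S, [/\ uniq S, forall b, b \in S -> B b & spanning S].
Proof.
have K c : exists se : seq ZS4 * (ZS4 -> int), (forall b, b \in se.1 -> B b) /\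
    class_ind c = \sum_(b <- se.1) b *~ se.2 b.
  have /(proj2 Bbasis) [s [e [h1 h2]]] := (central_class_fun _).2 (@class_fun_class_ind c).
  by exists (s, e).
have /fin_all_exists [k E] (c : 'I_5) := K c.
exists (undup (flatten [seq (k c).1 | c <- enum 'I_5])); split; first exact: undup_uniq.
  by move=> b; rewrite mem_undup => /flatten_mapP [c _ /(E c).1].
move=> c c5; have [_ ->] := E (Ordinal c5); apply: sum_subset; first exact: undup_uniq.
move=> b bk; rewrite mem_undup; apply/flatten_mapP; exists (Ordinal c5) => //.
by rewrite mem_enum.
Qed.

Lemma sum_filter (S : seq ZS4) (P : pred ZS4) (e : ZS4 -> int) (f : ZS4 -> int) :
  (forall b, b \in S -> ~~ P b -> f b = 0) ->
  \sum_(b <- S) f b * e b = \sum_(b <- [seq b <- S | P b]) f b * e b.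
Proof.
move=> h; rewrite big_filter (bigID P) /= [X in _ + X]big1_seq ?addr0 // => b /andP [nP bS].
by rewrite h // mul0r.
Qed.

Lemma free_filter (S : seq ZS4) (P : pred ZS4) (e : ZS4 -> int) :
  uniq S -> (forall b, b \in S -> B b) ->
  (forall c, (c < 5)%N -> \sum_(b <- [seq b <- S | P b]) crd c b * e b = 0) ->
  forall b, b \in [seq b <- S | P b] -> e b = 0.
Proof.
move=> uS SB h; apply: Bbasis.1; first exact: filter_uniq.
  by move=> b; rewrite mem_filter => /andP [_ /SB].
apply: class_fun_ext => [|g|c c5]; last by rewrite crd_sum h // /crd ffunE.
- by apply: class_fun_sum => b; rewrite mem_filter => /andP [_ /SB /Bcf].
- by rewrite !ffunE.
Qed.

(** Homogeneity makes the coordinate matrix block diagonal: coordinates 0 to 2 see only even members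
    and coordinates 3 and 4 only odd ones, so each block is square on its own. *)
Lemma spanning_split S : uniq S -> (forall b, b \in S -> B b) -> spanning S ->
  (exists u v w, [seq b <- S | even_elt b] = [:: u; v; w] /\ unitz (det3 (ecrd u) (ecrd v) (ecrd
    w))) /\
  (exists x y, [seq b <- S | ~~ even_elt b] = [:: x; y] /\ unitz (det2 (ocrd x) (ocrd y))).
Proof.
move=> uS SB Sspan; split.
  have [||sz [P E]] := @square_family 3 [seq b <- S | even_elt b] ecrd (filter_uniq _ uS).
  - move=> c c3; have [|e E] := Sspan c; first exact: leq_trans c3 _.
    exists e => c' c3'; have c5 : (c' < 5)%N by exact: leq_trans c3' _.
    rewrite -crd_class_ind // E crd_sum; symmetry; apply: (@sum_filter S even_elt e (crd c')) =>
      b /SB Bb.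
    by rewrite -(odd_eltE Bb) => /and3P [/eqP e0 /eqP e1 /eqP e2]; case: c' c3' c5 => [|[|[|]]].
  - move=> e h; apply: free_filter => // -[|[|[|[|[|]]]]] // _; try exact: h.
      by rewrite big1_seq // => b; rewrite mem_filter => /andP [_ /andP [/andP [/eqP -> _] _]];
        rewrite mul0r.
    by rewrite big1_seq // => b; rewrite mem_filter => /andP [_ /andP [/andP [_ /eqP ->] _]];
      rewrite mul0r.
  exact: square_family3 E.
have [||sz [P E]] := @square_family 2 [seq b <- S | ~~ even_elt b] ocrd (filter_uniq _ uS).
- move=> c c2; have [|e E] := Sspan (3 + c)%N; first by rewrite -(ltn_add2l 3) in c2.
  exists e => c' c2'; have c5 : (3 + c' < 5)%N by rewrite -(ltn_add2l 3) in c2'.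
  rewrite -(eqn_add2l 3 c') -crd_class_ind // E crd_sum; symmetry.
  apply: (@sum_filter S (fun b => ~~ even_elt b) e (crd (3 + c'))) => b _.
  by rewrite negbK => /andP [/eqP e3 /eqP e4]; case: c' c2' c5 => [|[|]].
- move=> e h; apply: free_filter => // c c5.
  have [c3|c3] := ltnP c 3; last by rewrite -(subnKC c3); apply: h; lia.
  rewrite big1_seq // => b; rewrite mem_filter => /andP [_ /andP [+ /SB Bb]].
  rewrite -(odd_eltE Bb) => /and3P [/eqP e0 /eqP e1 /eqP e2].
  by case: c c3 {c5} => [|[|[|]]] // _; rewrite ?e0 ?e1 ?e2 mul0r.
exact: square_family2 E.
Qed.

Lemma basis_split : exists u v w x y,
  [/\ forall b, B b <-> b \in [:: u; v; w; x; y],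
     unitz (det3 (ecrd u) (ecrd v) (ecrd w)), unitz (det2 (ocrd x) (ocrd y)),
     [&& even_elt u, even_elt v & even_elt w] & ~~ even_elt x && ~~ even_elt y].
Proof.
have [S [uS SB Sspan]] := spanning_exists.
have size5 T : uniq T -> (forall b, b \in T -> B b) -> spanning T -> size T = 5.
  move=> uT TB /(spanning_split uT TB) [[u [v [w [e _]]]] [x [y [e' _]]]].
  rewrite -(count_predC even_elt) -!size_filter e.
  by rewrite (eq_filter (a2 := fun b => ~~ even_elt b)) ?e'.
have BS b : B b -> b \in S.
  (* A member of [B] outside S could be added to S, giving a spanning family of size 6 against
     [size5]. *)
  move=> Bb; apply: contraT => bS; have := size5 (b :: S); rewrite /= bS uS size5 // => h.
  suff: 6%N = 5%N by [].
  apply: h => // [b'|c c5]; first by rewrite inE => /predU1P [->|/SB].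
  have [e ->] := Sspan c c5; apply: sum_subset; first by rewrite /= bS.
  by move=> b' b'S; rewrite inE b'S orbT.
have [[u [v [w [e d3]]]] [x [y [e' d2]]]] := spanning_split uS SB Sspan.
have ev b : b \in [:: u; v; w] -> even_elt b by rewrite -e mem_filter => /andP [].
have od b : b \in [:: x; y] -> ~~ even_elt b by rewrite -e' mem_filter => /andP [].
exists u, v, w, x, y; split=> //; first last.
- by rewrite !od // !inE eqxx ?orbT.
- by rewrite !ev // !inE eqxx ?orbT.
move=> b; have -> : (b \in [:: u; v; w; x; y]) = (b \in S).
  rewrite -[[:: u; v; w; x; y]]/([:: u; v; w] ++ [:: x; y]) -e -e' mem_cat !mem_filter.
  by case: (even_elt b); rewrite /= ?orbF.
by split=> [/BS|/SB].
Qed.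
End ForwardBasis.

(** * From unit determinants to a basis *)

Lemma free3 (u v w : nat -> int) (a b c : int) : unitz (det3 u v w) ->
  (forall i, (i < 3)%N -> u i * a + (v i * b + w i * c) = 0) -> [/\ a = 0, b = 0 & c = 0].
Proof.
move=> d h; have := (h 0%N isT, h 1%N isT, h 2%N isT); move: d {h}; rewrite /det3.
move: (u 0%N) (u 1%N) (u 2%N) (v 0%N) (v 1%N) (v 2%N) (w 0%N) (w 1%N) (w 2%N).
move=> u0 u1 u2 v0 v1 v2 w0 w1 w2; set d := (_ + _) => hd [[e0 e1] e2].
(* Cramer's rule: weighting the three equations by cofactors isolates d times one unknown. *)
have ha : d * a = 0.
  transitivity ((u0 * a + (v0 * b + w0 * c)) * (v1 * w2 - v2 * w1)
    - (u1 * a + (v1 * b + w1 * c)) * (v0 * w2 - v2 * w0)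
    + (u2 * a + (v2 * b + w2 * c)) * (v0 * w1 - v1 * w0)); first by rewrite /d; ring.
  by rewrite e0 e1 e2; ring.
have hb : d * b = 0.
  transitivity (- (u0 * a + (v0 * b + w0 * c)) * (u1 * w2 - u2 * w1)
    + (u1 * a + (v1 * b + w1 * c)) * (u0 * w2 - u2 * w0)
    - (u2 * a + (v2 * b + w2 * c)) * (u0 * w1 - u1 * w0)); first by rewrite /d; ring.
  by rewrite e0 e1 e2; ring.
have hc : d * c = 0.
  transitivity ((u0 * a + (v0 * b + w0 * c)) * (u1 * v2 - u2 * v1)
    - (u1 * a + (v1 * b + w1 * c)) * (u0 * v2 - u2 * v0)
    + (u2 * a + (v2 * b + w2 * c)) * (u0 * v1 - u1 * v0)); first by rewrite /d; ring.
  by rewrite e0 e1 e2; ring.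
by move: ha hb hc; case: hd => ->; split; lia.
Qed.

Lemma free2 (u v : nat -> int) (a b : int) : unitz (det2 u v) ->
  (forall i, (i < 2)%N -> u i * a + v i * b = 0) -> a = 0 /\ b = 0.
Proof.
move=> d h; have := (h 0%N isT, h 1%N isT); move: d {h}; rewrite /det2.
move: (u 0%N) (u 1%N) (v 0%N) (v 1%N) => u0 u1 v0 v1; set d := (_ - _) => hd [e0 e1].
have ha : d * a = 0.
  transitivity ((u0 * a + v0 * b) * v1 - (u1 * a + v1 * b) * v0); first by rewrite /d; ring.
  by rewrite e0 e1; ring.
have hb : d * b = 0.
  transitivity ((u1 * a + v1 * b) * u0 - (u0 * a + v0 * b) * u1); first by rewrite /d; ring.
  by rewrite e0 e1; ring.
by move: ha hb; case: hd => ->; split; lia.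
Qed.

(** Cramer's rule, where d^2 = 1 lets d serve as its own inverse. *)
Lemma span3 (u v w z : nat -> int) : unitz (det3 u v w) ->
  exists a b c, forall i, (i < 3)%N -> u i * a + (v i * b + w i * c) = z i.
Proof.
move=> hd; have dd : det3 u v w * det3 u v w = 1 by case: hd => ->.
exists (det3 u v w * det3 z v w), (det3 u v w * det3 u z w), (det3 u v w * det3 u v z).
move=> i i3; rewrite -[RHS]mul1r -dd.
by case: i i3 => [|[|[|]]] // _; rewrite /det3; ring.
Qed.

Lemma span2 (u v z : nat -> int) : unitz (det2 u v) ->
  exists a b, forall i, (i < 2)%N -> u i * a + v i * b = z i.
Proof.
move=> hd; have dd : det2 u v * det2 u v = 1 by case: hd => ->.
exists (det2 u v * det2 z v), (det2 u v * det2 u z) => i i2; rewrite -[RHS]mul1r -dd.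
by case: i i2 => [|[|]] // _; rewrite /det2; ring.
Qed.

Lemma basis_of_unitz (B : ZS4 -> Prop) u v w x y :
  (forall b, B b <-> b \in [:: u; v; w; x; y]) ->
  (forall b, b \in [:: u; v; w; x; y] -> class_fun b) ->
  unitz (det3 (ecrd u) (ecrd v) (ecrd w)) -> unitz (det2 (ocrd x) (ocrd y)) ->
  [&& even_elt u, even_elt v & even_elt w] -> odd_elt x && odd_elt y ->
  is_Zbasis_of_centre B.
Proof.
move=> BE cf d3 d2 /and3P [/andP [/eqP u3 /eqP u4] /andP [/eqP v3 /eqP v4] /andP [/eqP w3 /eqP w4]].
move=> /andP [/and3P [/eqP x0 /eqP x1 /eqP x2] /and3P [/eqP y0 /eqP y1 /eqP y2]].
have comb (e : ZS4 -> int) c : (c < 5)%N -> crd c (\sum_(b <- [:: u; v; w; x; y]) b *~ e b) =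
    if (c < 3)%N then ecrd u c * e u + (ecrd v c * e v + ecrd w c * e w)
    else ocrd x (c - 3) * e x + ocrd y (c - 3) * e y.
  rewrite crd_sum !big_cons big_nil addr0.
  by case: c => [|[|[|[|[|]]]]] // _; rewrite /ecrd /ocrd /= ?x0 ?x1 ?x2 ?y0 ?y1 ?y2 ?u3 ?u4 ?v3
    ?v4 ?w3 ?w4; ring.
have free (e : ZS4 -> int) : \sum_(b <- [:: u; v; w; x; y]) b *~ e b = 0 ->
    [/\ e u = 0, e v = 0 & e w = 0] /\ (e x = 0 /\ e y = 0).
  move=> E; have {}comb c c5 := comb e c c5; rewrite E in comb.
  split; [apply: free3 d3 _ => i i3 | apply: free2 d2 _ => i i2].
    by have := comb i (leq_trans i3 _); rewrite i3 => <- //; rewrite /crd ffunE.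
  have := comb (3 + i)%N; rewrite -[(_ < 5)%N]/(3 + i < 3 + 2)%N ltn_add2l i2 => /(_ isT).
  by rewrite ltnNge leq_addr /= addKn => <-; rewrite /crd ffunE.
have uS : uniq [:: u; v; w; x; y].
  (* A repetition within a block, or an even element equal to x or y, would make a determinant
     vanish. *)
  have ne3 a b : unitz a -> b = 0 -> a = b -> False by rewrite /unitz; lia.
  have uv : u != v by apply/eqP => e; apply: (ne3 _ 0 d3) => //; rewrite e /det3; ring.
  have uw : u != w by apply/eqP => e; apply: (ne3 _ 0 d3) => //; rewrite e /det3; ring.
  have vw : v != w by apply/eqP => e; apply: (ne3 _ 0 d3) => //; rewrite e /det3; ring.
  have xy : x != y by apply/eqP => e; apply: (ne3 _ 0 d2) => //; rewrite e /det2; ring.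
  have nex z : crd 3 z = 0 -> crd 4 z = 0 -> z != x.
    move=> z3 z4; apply/eqP => e; apply: (ne3 _ 0 d2) => //.
    by rewrite -e /det2 /ocrd /= z3 z4; ring.
  have ney z : crd 3 z = 0 -> crd 4 z = 0 -> z != y.
    move=> z3 z4; apply/eqP => e; apply: (ne3 _ 0 d2) => //.
    by rewrite -e /det2 /ocrd /= z3 z4; ring.
  by rewrite /= !inE !negb_or uv uw vw xy !nex // !ney.
split=> [s e us sB E b bs|z].
  have sub : {subset s <= [:: u; v; w; x; y]} by move=> b' /sB /BE.
  (* Extension by 0 turns a relation on a subfamily into one on all five elements. *)
  pose e' b := if b \in s then e b else 0.
  have E' : \sum_(b <- [:: u; v; w; x; y]) b *~ e' b = 0.
    rewrite -[RHS]E (bigID (mem s)) /= [X in _ + X]big1 ?addr0; last first.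
      by move=> b' /negPf nb; rewrite /e' nb mulr0z.
    rewrite -big_filter (perm_big s); last first.
      apply: uniq_perm => // [|b']; first exact: filter_uniq.
      by rewrite mem_filter andb_idr //; exact: sub.
    by apply: eq_big_seq => b' b's; rewrite /e' b's.
  have := free _ E' => -[[eu ev ew] [ex ey]].
  have : e' b = 0 by move: (sub _ bs); rewrite !inE => /or4P [||| /orP []] /eqP ->.
  by rewrite /e' bs.
rewrite central_class_fun; split=> [cz|[s [e [sB ->]]]]; last first.
  by apply: class_fun_sum => b /sB /BE /cf.
have [a1 [a2 [a3 h3]]] := span3 (ecrd z) d3.
have [c1 [c2 h2]] := span2 (ocrd z) d2.
pose e (b : ZS4) := if b == u then a1 else if b == v then a2 else if b == w then a3
  else if b == x then c1 else c2.
exists [:: u; v; w; x; y], e; split=> [b /BE //|].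
have [eu ev ew ex ey] : [/\ e u = a1, e v = a2, e w = a3, e x = c1 & e y = c2].
  move: uS => /=; rewrite !inE !negb_or => /and5P [/and4P [uv uw ux uy] /and3P [vw vx vy] /andP
    [wx wy] xy _].
  by rewrite /e !eqxx (eq_sym v u) (eq_sym w u) (eq_sym x u) (eq_sym y u) (eq_sym w v)
    (eq_sym x v) (eq_sym y v) (eq_sym x w) (eq_sym y w) (eq_sym y x) (negPf uv) (negPf uw)
    (negPf ux) (negPf uy) (negPf vw) (negPf vx) (negPf vy) (negPf wx) (negPf wy) (negPf xy).
apply: class_fun_ext => // [|c c5]; first exact: class_fun_sum.
rewrite comb // eu ev ew ex ey; case: ifP => [c3|c3]; first by rewrite h3.
by rewrite h2 /ocrd; [rewrite subnKC // leqNgt c3 | lia].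
Qed.

(** * Classification *)

Lemma unitzN x : unitz (- x) -> unitz x.
Proof. by rewrite /unitz; lia. Qed.

Lemma unitz_oddz x : unitz x -> oddz x.
Proof. by case=> ->. Qed.

Lemma det3_swap12 u v w : det3 v u w = - det3 u v w. Proof. by rewrite /det3; ring. Qed.
Lemma det3_swap23 u v w : det3 u w v = - det3 u v w. Proof. by rewrite /det3; ring. Qed.
Lemma det2_swap u v : det2 v u = - det2 u v. Proof. by rewrite /det2; ring. Qed.

Lemma ekind_epar z : ekind z ->
  epar z \in [:: (true, false, false); (false, true, true); (false, true, false); (false, false,
    false)].
Proof.
case=> [[k /negPf ok ->]|[l ol ->]|[i ->]|->] //; rewrite ?epar_ll0 ?epar_ii2 ?ok ?ol //.
Qed.

Lemma ekind_tff z : ekind z -> epar z = (true, false, false) ->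
  exists2 k, ~~ odd k & z = tripZ [:: k; k; 0%N].
Proof. by case=> [//|[l ol ->]|[i ->]|->] //; rewrite ?epar_ll0 ?epar_ii2 ?ol. Qed.

Lemma ekind_ftt z : ekind z -> epar z = (false, true, true) ->
  exists2 l, odd l & z = tripZ [:: l; l; 0%N].
Proof. by case=> [[k /negPf ok ->]|//|[i ->]|->] //; rewrite ?epar_ll0 ?epar_ii2 ?ok. Qed.

Lemma ekind_ftf z : ekind z -> epar z = (false, true, false) ->
  exists i, z = tripZ [:: i; i; 2%N].
Proof. by case=> [[k /negPf ok ->]|[l ol ->]|//|->] //; rewrite ?epar_ll0 ?ol ?ok. Qed.

Lemma even_order u v w : ekind u -> ekind v -> ekind w ->
  unitz (det3 (ecrd u) (ecrd v) (ecrd w)) ->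
  exists k l i, [/\ ~~ odd k, odd l,
    perm_eq [:: u; v; w] [:: tripZ [:: k; k; 0%N]; tripZ [:: l; l; 0%N]; tripZ [:: i; i; 2%N]] &
    unitz (det3 (ecrd (tripZ [:: k; k; 0%N])) (ecrd (tripZ [:: l; l; 0%N])) (ecrd (tripZ [:: i;
      i; 2%N])))].
Proof.
move=> ku kv kw.
suff core a b c : perm_eq [:: u; v; w] [:: a; b; c] -> ekind a -> ekind b -> ekind c ->
    unitz (det3 (ecrd a) (ecrd b) (ecrd c)) -> epar a = (true, false, false) ->
    epar b = (false, true, true) -> epar c = (false, true, false) ->
    exists k l i, [/\ ~~ odd k, odd l,
    perm_eq [:: u; v; w] [:: tripZ [:: k; k; 0%N]; tripZ [:: l; l; 0%N]; tripZ [:: i; i; 2%N]] &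
    unitz (det3 (ecrd (tripZ [:: k; k; 0%N])) (ecrd (tripZ [:: l; l; 0%N])) (ecrd (tripZ [:: i;
      i; 2%N])))].
  have p1 : perm_eq [:: u; v; w] [:: u; w; v].
    by rewrite perm_cons; apply/permPl; exact: (perm_catC [:: v] [:: w]).
  have p2 : perm_eq [:: u; v; w] [:: v; u; w].
    by apply/permPl; exact: (perm_catCA [:: u] [:: v] [:: w]).
  have p3 : perm_eq [:: u; v; w] [:: v; w; u].
    by apply/permPl; exact: (perm_catC [:: u] [:: v; w]).
  have p4 : perm_eq [:: u; v; w] [:: w; u; v].
    by apply/permPl; exact: (perm_catC [:: u; v] [:: w]).
  have p5 : perm_eq [:: u; v; w] [:: w; v; u].
    by apply: perm_trans p3 _; apply/permPl; exact: (perm_catCA [:: v] [:: w] [:: u]).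
  (* Of the 64 combinations of residue vectors, only the six arrangements of the three nonzero
     vectors have odd determinant. *)
  move=> d; have := unitz_oddz d.
  rewrite /det3 !(oddzD, oddzN, oddzM).
  have d1 : unitz (det3 (ecrd u) (ecrd w) (ecrd v)) by apply: unitzN; rewrite -det3_swap23.
  have d2 : unitz (det3 (ecrd v) (ecrd u) (ecrd w)) by apply: unitzN; rewrite -det3_swap12.
  have d3 : unitz (det3 (ecrd v) (ecrd w) (ecrd u)) by apply: unitzN; rewrite -det3_swap23.
  have d4 : unitz (det3 (ecrd w) (ecrd u) (ecrd v)) by apply: unitzN; rewrite -det3_swap12.
  have d5 : unitz (det3 (ecrd w) (ecrd v) (ecrd u)) by apply: unitzN; rewrite -det3_swap12.
  have := ekind_epar kw; have := ekind_epar kv; have := ekind_epar ku.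
  rewrite !inE => /or4P [] /eqP eu /or4P [] /eqP ev /or4P [] /eqP ew;
    (move: (eu) (ev) (ew) => [-> -> ->] [-> -> ->] [-> -> ->] //= _);
    by [apply: (core u v w) | apply: (core u w v) | apply: (core v u w)
       | apply: (core v w u) | apply: (core w u v) | apply: (core w v u)].
move=> p ka kb kc d ea eb ec.
have [k ok ek] := ekind_tff ka ea; have [l ol el] := ekind_ftt kb eb.
by have [i ei] := ekind_ftf kc ec; exists k, l, i; split; rewrite -?ek -?el -?ei.
Qed.

Lemma okind_opar z : okind z ->
  opar z \in [:: (true, false); (true, true); (false, true); (false, false)].
Proof.
case=> [->|[[k [ok k1 ->]]|[i [j [oi oj j0 ->]]]|[i i0 ->]|->]] //.
- by rewrite (opar_ii1 0).
- by rewrite opar_00k.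
- by rewrite opar_ij0.
- by rewrite opar_ii1 gtn_eqF.
Qed.

Lemma okind_tf z : okind z -> opar z = (true, false) -> z = tripZ [:: 0; 0; 1]%N.
Proof.
case=> [//|[[k [ok k1 ->]]|[i [j [oi oj j0 ->]]]|[i i0 ->]|->]] //.
- by rewrite opar_00k.
- by rewrite opar_ij0.
- by rewrite opar_ii1 gtn_eqF.
Qed.

Lemma okind_tt z : okind z -> opar z = (true, true) ->
  (exists k, [/\ odd k, k != 1%N & z = tripZ [:: 0%N; 0%N; k]]) \/
  (exists i j, [/\ odd i, ~~ odd j, (0 < j)%N & z = tripZ [:: i; j; 0%N]]).
Proof.
case=> [->|[h|h|[i i0 ->]|->]] //; try by [left | right].
- by rewrite (opar_ii1 0).
- by rewrite opar_ii1 gtn_eqF.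
Qed.

Lemma okind_ft z : okind z -> opar z = (false, true) ->
  exists2 i, (0 < i)%N & z = tripZ [:: i; i; 1%N].
Proof.
case=> [->|[[k [ok k1 ->]]|[i [j [oi oj j0 ->]]]|//|->]] //.
- by rewrite (opar_ii1 0).
- by rewrite opar_00k.
- by rewrite opar_ij0.
Qed.

Definition odd_pair (t : seq nat) := t \in [:: [:: 0; 0; 3]; [:: 1; 1; 1]]%N.

Lemma odd_order x y : okind x -> okind y -> unitz (det2 (ocrd x) (ocrd y)) ->
  exists2 t, odd_pair t & perm_eq [:: x; y] [:: tripZ [:: 0; 0; 1]%N; tripZ t].
Proof.
move=> kx ky.
have pC : perm_eq [:: x; y] [:: y; x] by apply/permPl; exact: (perm_catC [:: x] [:: y]).
suff core a b : perm_eq [:: x; y] [:: a; b] -> okind a -> okind b ->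
    unitz (det2 (ocrd a) (ocrd b)) ->
    [\/ opar a = (true, false) /\ opar b = (true, true), opar a = (true, false) /\ opar b =
      (false, true)
      | opar a = (true, true) /\ opar b = (false, true)] ->
    exists2 t, odd_pair t & perm_eq [:: x; y] [:: tripZ [:: 0; 0; 1]%N; tripZ t].
  (* Any two distinct nonzero vectors modulo 2 are independent, so three unordered pairs remain,
     each in two orders. *)
  move=> d; have := unitz_oddz d; rewrite /det2 !(oddzD, oddzN, oddzM).
  have d' : unitz (det2 (ocrd y) (ocrd x)) by apply: unitzN; rewrite -det2_swap.
  have := okind_opar ky; have := okind_opar kx.
  rewrite !inE => /or4P [] /eqP ex /or4P [] /eqP ey;
    (move: (ex) (ey) => [-> ->] [-> ->] //= _);
    by [apply: (core x y) => //; constructor | apply: (core x y) => //; constructor 2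
       | apply: (core x y) => //; constructor 3 | apply: (core y x) => //; constructor
       | apply: (core y x) => //; constructor 2 | apply: (core y x) => //; constructor 3].
move=> p ka kb d [[ea eb]|[ea eb]|[ea eb]].
- rewrite (okind_tf ka ea) in p d *.
  case: (okind_tt kb eb) => [[k [ok k1 ek]]|[i [j [oi oj j0 ek]]]]; rewrite ek in p d.
    by exists [:: 0%N; 0%N; k] => //; rewrite (unitz_001_00k ok d).
  by case: (nunitz_001_ij0 oi oj j0 d).
- rewrite (okind_tf ka ea) in p d *; have [i i0 ei] := okind_ft kb eb; rewrite ei in p d.
  by exists [:: i; i; 1%N] => //; rewrite (unitz_001_ii1 i0 d).
- have [i i0 ei] := okind_ft kb eb; rewrite ei in d.
  case: (okind_tt ka ea) => [[k [ok k1 ek]]|[i' [j [oi oj j0 ek]]]]; rewrite ek in d.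
    by case: (nunitz_00k_ii1 ok k1 i0 d).
  by case: (nunitz_ij0_ii1 oi oj j0 i0 d).
Qed.

(** Here k = 0 and k = 2 stand for the empty partition and (2,2), l = 1 for (1,1), and i = 0 and i =
    2 for (2) and (2,2,2). *)
Definition even_good k l i := (l == 1%N) &&
  ((k == 0%N) && [|| i == 0, i == 2 | odd i]%N || (k == 2%N) && ((i == 0%N) || (i == 2%N))).

Lemma even_goodP k l i : ~~ odd k -> odd l ->
  unitz (det3 (ecrd (tripZ [:: k; k; 0%N])) (ecrd (tripZ [:: l; l; 0%N])) (ecrd (tripZ [:: i; i;
    2%N]))) ->
  even_good k l i.
Proof.
move=> ok ol; have [->|k0] := posnP k.
  by move=> /(unitz_000_ll0_ii2 ol) [-> h]; rewrite /even_good /= h.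
by move=> /(unitz_kk0_ll0_ii2 k0 ok ol) [-> -> h]; rewrite /even_good /= h.
Qed.

Lemma vals_kk0_even k : ~~ odd k -> [/\ vals [:: k; k; 0%N] 0 = (if k == 0%N then 1 else pow236
  (fun x n => x ^+ n) k),
   vals [:: k; k; 0%N] 1 = (if k == 0%N then 1 else 1 + 2 * 2 ^+ k) & vals [:: k; k; 0%N] 2 = 1].
Proof.
move=> ok; case: k ok => [|k] ok; first by have [] := vals_000.
by have := @vals_ll0 k.+1 isT; rewrite (negPf ok).
Qed.

Lemma even_good_unitz k l i : even_good k l i ->
  unitz (det3 (ecrd (tripZ [:: k; k; 0%N])) (ecrd (tripZ [:: l; l; 0%N])) (ecrd (tripZ [:: i; i;
    2%N]))).
Proof.
move=> /andP [/eqP -> g].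
have ok : ~~ odd k by case/orP: g => /andP [/eqP ->].
have ek : ~~ odd (k + (k + 0)) by rewrite addn0 addnn odd_double.
have ei : ~~ odd (i + (i + 2)) by rewrite addnA addnn oddD odd_double.
have := @det3_vals [:: k; k; 0]%N [:: 1; 1; 0]%N [:: i; i; 2]%N erefl erefl erefl ek isT ei.
set d := det3 (ecrd _) _ _; move: d => d; rewrite /det3.
have [-> -> ->] := vals_kk0_even ok; have [-> -> ->] := @vals_ll0 1 isT.
rewrite /= (_ : pow236 _ 1 = 11) // /unitz.
case: (vals_ii2P i) => [[ei' -> -> ->]|[ei' -> -> ->]|[oi -> -> ->]|[oi i4 _ _ _]].
- by case/orP: g => /andP [/eqP -> _] /=; rewrite ?pow236_2 ?sqr2; lia.
- by case/orP: g => /andP [/eqP -> _] /=; rewrite ?pow236_2 ?sqr2; lia.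
- have ->: k = 0%N by case/orP: g => /andP [/eqP -> //] /orP [] /eqP e; move: oi; rewrite e.
  by rewrite eqxx; lia.
- by move: g; rewrite (negPf oi) orbF; case: i i4 {ei oi} => [|[|[|i]]] //=; rewrite !andbF.
Qed.

Lemma odd_pair_unitz t : odd_pair t -> unitz (det2 (ocrd (tripZ [:: 0; 0; 1]%N)) (ocrd (tripZ t))).
Proof.
rewrite /odd_pair !inE => /orP [] /eqP ->.
  have := @det2_vals [:: 0; 0; 1]%N [:: 0; 0; 3]%N erefl erefl isT isT; move: (det2 (ocrd _) _)
    => d.
  by rewrite /det2; have [-> ->] := @vals_00k 1 isT; have [-> ->] := @vals_00k 3 isT; rewrite
    /unitz; lia.
have := @det2_vals [:: 0; 0; 1]%N [:: 1; 1; 1]%N erefl erefl isT isT; move: (det2 (ocrd _) _) => d.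
by rewrite /det2; have [-> ->] := @vals_00k 1 isT; have [-> ->] := vals_111; rewrite /unitz; lia.
Qed.

Lemma tripZ_even_elt s : size s = 3 -> ~~ odd (sumn s) -> even_elt (tripZ s).
Proof. by move=> s3 /(tripZ_even s3) [_ _ _ e3 e4]; rewrite /even_elt e3 e4. Qed.

Lemma tripZ_odd_elt s : size s = 3 -> odd (sumn s) -> odd_elt (tripZ s).
Proof. by move=> s3 /(tripZ_odd s3) [_ _ e0 e1 e2]; rewrite /odd_elt e0 e1 e2. Qed.

Definition good_set k i t :=
  [:: tripZ [:: k; k; 0%N]; tripZ [:: 1; 1; 0]%N; tripZ [:: i; i; 2%N]; tripZ [:: 0; 0; 1]%N;
    tripZ t].

Lemma good_set_basis (B : ZS4 -> Prop) k i t : even_good k 1 i -> odd_pair t ->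
  (forall b, B b <-> b \in good_set k i t) -> is_Zbasis_of_centre B.
Proof.
move=> g ht BE.
have t3 : size t = 3 by move: ht; rewrite /odd_pair !inE => /orP [] /eqP ->.
have ot : odd (sumn t) by move: ht; rewrite /odd_pair !inE => /orP [] /eqP ->.
apply: basis_of_unitz BE _ (even_good_unitz g) (odd_pair_unitz ht) _ _.
- by move=> b; rewrite !inE => /or4P [||| /orP []] /eqP ->; exact: tripZ_class.
- by rewrite !tripZ_even_elt //= ?addn0 ?addnA addnn ?oddD odd_double.
- by rewrite !tripZ_odd_elt.
Qed.

Lemma m_mu_kind mu : is_partition mu -> let b := m_mu mu in
  [/\ class_fun b, even_elt b || odd_elt b, even_elt b -> ekind b & ~~ even_elt b -> okind b].
Proof.
move=> /m_mu_triple [->|[i [j [k [ji kj ->]]]]] /=.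
  have c0 c : crd c 0 = 0 by rewrite /crd ffunE.
  split; rewrite /even_elt ?c0 //; first by move=> g; rewrite !ffunE.
  by constructor 4; rewrite /epar !c0.
split; first exact: tripZ_class.
- case o: (odd (i + (j + (k + 0)))); [rewrite orbC tripZ_odd_elt // | by rewrite tripZ_even_elt
  //= o].
- case o: (odd (i + (j + k))) => e; last by apply: ekindP; rewrite ?o.
  (* In odd degree the even coordinates vanish, so such an element counts as zero modulo 2. *)
  constructor 4; have := @tripZ_odd_elt [:: i; j; k]; rewrite /= addn0 o.
  by rewrite /epar => /(_ erefl isT) /and3P [/eqP -> /eqP -> /eqP ->].
- move=> ne; apply: okindP => //; apply: contraNT ne => o.
  by rewrite tripZ_even_elt //= addn0.
Qed.

Lemma basis_good_set (B : ZS4 -> Prop) :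
  (forall b, B b -> exists mu, is_partition mu /\ b = m_mu mu) -> is_Zbasis_of_centre B ->
  exists k i t, [/\ even_good k 1 i, odd_pair t & forall b, B b <-> b \in good_set k i t].
Proof.
move=> Bm Bb.
have kind b : B b -> [/\ class_fun b, even_elt b || odd_elt b, even_elt b -> ekind b & ~~
  even_elt b -> okind b].
  by move=> /Bm [mu [pmu ->]]; exact: m_mu_kind.
have [|b|u [v [w [x [y [BE d3 d2 /and3P [eu ev ew] /andP [ox oy]]]]]]] := basis_split (B := B) _
  _ Bb.
- by move=> b /kind [].
- by move=> /kind [].
have Bu : B u by apply/BE; rewrite !inE eqxx.
have Bv : B v by apply/BE; rewrite !inE eqxx !orbT.
have Bw : B w by apply/BE; rewrite !inE eqxx !orbT.
have Bx : B x by apply/BE; rewrite !inE eqxx !orbT.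
have By : B y by apply/BE; rewrite !inE eqxx !orbT.
have [_ _ /(_ eu) ku _] := kind _ Bu; have [_ _ /(_ ev) kv _] := kind _ Bv.
have [_ _ /(_ ew) kw _] := kind _ Bw.
have [_ _ _ /(_ ox) kx] := kind _ Bx; have [_ _ _ /(_ oy) ky] := kind _ By.
have [k [l [i [ok ol pe /(even_goodP ok ol) g]]]] := even_order ku kv kw d3.
have [t ht po] := odd_order kx ky d2.
have l1 : l = 1%N by case/andP: g => /eqP.
subst l; exists k, i, t; split=> // b; rewrite BE.
by rewrite (perm_mem (perm_cat pe po) b).
Qed.

(** * Translation to the listed partitions *)

Lemma m_mu_ii2 i : m_mu (mu_ii2 i) = tripZ [:: i; i; 2%N].
Proof.
rewrite m_mu_tripZ size_sort //= cats0; apply: tripZ_perm.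
exact/permPl/perm_sort.
Qed.

Lemma m_mu_small :
  [/\ m_mu [::] = tripZ [:: 0; 0; 0]%N, m_mu [:: 1]%N = tripZ [:: 0; 0; 1]%N,
      m_mu [:: 2]%N = tripZ [:: 0; 0; 2]%N, m_mu [:: 3]%N = tripZ [:: 0; 0; 3]%N
    & m_mu [:: 1; 1]%N = tripZ [:: 1; 1; 0]%N] /\
  [/\ m_mu [:: 2; 2]%N = tripZ [:: 2; 2; 0]%N, m_mu [:: 1; 1; 1]%N = tripZ [:: 1; 1; 1]%N
    & m_mu [:: 2; 2; 2]%N = tripZ [:: 2; 2; 2]%N].
Proof. by do !split; rewrite m_mu_tripZ // -?tripZ_rot // -tripZ_rot. Qed.

Close Scope ring_scope.

Theorem theorem3p5 (B : ZS4 -> Prop) :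
  (forall b, B b -> exists mu, is_partition mu /\ b = m_mu mu) ->
  (is_Zbasis_of_centre B <->
   (exists S : seq ZS4,
      S \in [:: [:: m_mu [::]; m_mu [:: 1]; m_mu [:: 2]; m_mu [:: 1; 1]; m_mu [:: 1; 1; 1]];
                [:: m_mu [::]; m_mu [:: 1]; m_mu [:: 1; 1]; m_mu [:: 1; 1; 1]; m_mu [:: 2; 2; 2]];
                [:: m_mu [:: 1]; m_mu [:: 2]; m_mu [:: 1; 1]; m_mu [:: 1; 1; 1]; m_mu [:: 2; 2]];
                [:: m_mu [:: 1]; m_mu [:: 1; 1]; m_mu [:: 1; 1; 1]; m_mu [:: 2; 2]; m_mu [:: 2; 2; 2]];
                [:: m_mu [::]; m_mu [:: 1]; m_mu [:: 2]; m_mu [:: 1; 1]; m_mu [:: 3]];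
                [:: m_mu [::]; m_mu [:: 1]; m_mu [:: 1; 1]; m_mu [:: 2; 2; 2]; m_mu [:: 3]];
                [:: m_mu [:: 1]; m_mu [:: 2]; m_mu [:: 1; 1]; m_mu [:: 3]; m_mu [:: 2; 2]];
                [:: m_mu [:: 1]; m_mu [:: 1; 1]; m_mu [:: 3]; m_mu [:: 2; 2]; m_mu [:: 2; 2; 2]]]
      /\ forall x, B x <-> x \in S)
   \/ (exists i : nat, odd i /\
        forall x, B x <-> x \in [:: m_mu [::]; m_mu [:: 1]; m_mu [:: 1; 1];
                                   m_mu [:: 1; 1; 1]; m_mu (mu_ii2 i)])
   \/ (exists i : nat, odd i /\
        forall x, B x <-> x \in [:: m_mu [::]; m_mu [:: 1]; m_mu [:: 1; 1];
                                   m_mu [:: 3]; m_mu (mu_ii2 i)])).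
Proof.
move=> Bm; have [[e0 e1 e2 e3 e11] [e22 e111 e222]] := m_mu_small.
(* Naming the eight elements keeps conversion from comparing them by computation. *)
have name (z : ZS4) : exists y, y = z by exists z.
have [z0 h0] := name (tripZ [:: 0; 0; 0]).
have [z1 h1] := name (tripZ [:: 0; 0; 1]).
have [z2 h2] := name (tripZ [:: 0; 0; 2]).
have [z3 h3] := name (tripZ [:: 0; 0; 3]).
have [z11 h11] := name (tripZ [:: 1; 1; 0]).
have [z22 h22] := name (tripZ [:: 2; 2; 0]).
have [z111 h111] := name (tripZ [:: 1; 1; 1]).
have [z222 h222] := name (tripZ [:: 2; 2; 2]).
rewrite e0 -h0 e1 -h1 e2 -h2 e3 -h3 e11 -h11 e22 -h22 e111 -h111 e222 -h222.
have perm_set (S S' : seq ZS4) : (forall x, B x <-> x \in S) -> S =i S' -> forall x, B x <-> x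
  \in S'.
  by move=> h e x; rewrite h e.
split=> [/(basis_good_set Bm) [k [i [t [/andP [_ g] ht BE]]]]|].
  have {}g : (k = 0 /\ [\/ i = 0, i = 2 | odd i]) \/ (k = 2 /\ (i = 0 \/ i = 2)).
    case/orP: g => /andP [/eqP -> h]; [left | right]; split=> //.
      by case/or3P: h => [/eqP ->|/eqP ->|->]; [constructor 1|constructor 2|constructor 3].
    by case/orP: h => /eqP ->; [left | right].
  (* Two choices of t and five of (k, i) give the ten listed families. *)
  move: ht; rewrite /odd_pair !inE => /orP [] /eqP et; subst t;
    case: g => [[ek [ei|ei|oi]]|[ek [ei|ei]]]; subst k; try subst i;
    rewrite /good_set -?h0 -?h1 -?h2 -?h3 -?h11 -?h22 -?h111 -?h222 in BE.
  - left; exists [:: z0; z1; z2; z11; z3]; split; first by rewrite !inE eqxx ?orbT.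
    apply: perm_set BE _ => x; rewrite !inE.
    by case: (x == z0); case: (x == z1); case: (x == z2); case: (x == z11); case: (x == z3).
  - left; exists [:: z0; z1; z11; z222; z3]; split; first by rewrite !inE eqxx ?orbT.
    apply: perm_set BE _ => x; rewrite !inE.
    by case: (x == z0); case: (x == z1); case: (x == z11); case: (x == z222); case: (x == z3).
  - right; right; exists i; split=> //; apply: perm_set BE _ => x.
    by rewrite m_mu_ii2 !inE; case: (x == z0); case: (x == z1); case: (x == z11); case: (x ==
      z3); case: (x == tripZ [:: i; i; 2]).
  - left; exists [:: z1; z2; z11; z3; z22]; split; first by rewrite !inE eqxx ?orbT.
    apply: perm_set BE _ => x; rewrite !inE.
    by case: (x == z1); case: (x == z2); case: (x == z11); case: (x == z3); case: (x == z22).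
  - left; exists [:: z1; z11; z3; z22; z222]; split; first by rewrite !inE eqxx ?orbT.
    apply: perm_set BE _ => x; rewrite !inE.
    by case: (x == z1); case: (x == z11); case: (x == z3); case: (x == z22); case: (x == z222).
  - left; exists [:: z0; z1; z2; z11; z111]; split; first by rewrite !inE eqxx ?orbT.
    apply: perm_set BE _ => x; rewrite !inE.
    by case: (x == z0); case: (x == z1); case: (x == z2); case: (x == z11); case: (x == z111).
  - left; exists [:: z0; z1; z11; z111; z222]; split; first by rewrite !inE eqxx ?orbT.
    apply: perm_set BE _ => x; rewrite !inE.
    by case: (x == z0); case: (x == z1); case: (x == z11); case: (x == z111); case: (x == z222).
  - right; left; exists i; split=> //; apply: perm_set BE _ => x.
    by rewrite m_mu_ii2 !inE; case: (x == z0); case: (x == z1); case: (x == z11); case: (x ==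
      z111); case: (x == tripZ [:: i; i; 2]).
  - left; exists [:: z1; z2; z11; z111; z22]; split; first by rewrite !inE eqxx ?orbT.
    apply: perm_set BE _ => x; rewrite !inE.
    by case: (x == z1); case: (x == z2); case: (x == z11); case: (x == z111); case: (x == z22).
  - left; exists [:: z1; z11; z111; z22; z222]; split; first by rewrite !inE eqxx ?orbT.
    apply: perm_set BE _ => x; rewrite !inE.
    by case: (x == z1); case: (x == z11); case: (x == z111); case: (x == z22); case: (x == z222).
case=> [[S [+ BS]]|[[i [oi BS]]|[i [oi BS]]]].
- rewrite !inE => S8.
  (* The eight fixed lists come from k and i in {0, 2} and the two choices of t. *)
  have [k [i [t [g ht e]]]] : exists k i t, [/\ even_good k 1 i, odd_pair t & S =i good_set k i t].
    move: S8; do 7?[case/orP]; move=> /eqP ->.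
    - exists 0, 0, [:: 1; 1; 1]; split=> // x.
      by rewrite /good_set -?h0 -?h1 -?h2 -?h3 -?h11 -?h22 -?h111 -?h222 !inE; case: (x == z0);
        case: (x == z1); case: (x == z2); case: (x == z11); case: (x == z111).
    - exists 0, 2, [:: 1; 1; 1]; split=> // x.
      by rewrite /good_set -?h0 -?h1 -?h2 -?h3 -?h11 -?h22 -?h111 -?h222 !inE; case: (x == z0);
        case: (x == z1); case: (x == z11); case: (x == z111); case: (x == z222).
    - exists 2, 0, [:: 1; 1; 1]; split=> // x.
      by rewrite /good_set -?h0 -?h1 -?h2 -?h3 -?h11 -?h22 -?h111 -?h222 !inE; case: (x == z1);
        case: (x == z2); case: (x == z11); case: (x == z111); case: (x == z22).
    - exists 2, 2, [:: 1; 1; 1]; split=> // x.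
      by rewrite /good_set -?h0 -?h1 -?h2 -?h3 -?h11 -?h22 -?h111 -?h222 !inE; case: (x == z1);
        case: (x == z11); case: (x == z111); case: (x == z22); case: (x == z222).
    - exists 0, 0, [:: 0; 0; 3]; split=> // x.
      by rewrite /good_set -?h0 -?h1 -?h2 -?h3 -?h11 -?h22 -?h111 -?h222 !inE; case: (x == z0);
        case: (x == z1); case: (x == z2); case: (x == z11); case: (x == z3).
    - exists 0, 2, [:: 0; 0; 3]; split=> // x.
      by rewrite /good_set -?h0 -?h1 -?h2 -?h3 -?h11 -?h22 -?h111 -?h222 !inE; case: (x == z0);
        case: (x == z1); case: (x == z11); case: (x == z222); case: (x == z3).
    - exists 2, 0, [:: 0; 0; 3]; split=> // x.
      by rewrite /good_set -?h0 -?h1 -?h2 -?h3 -?h11 -?h22 -?h111 -?h222 !inE; case: (x == z1);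
        case: (x == z2); case: (x == z11); case: (x == z3); case: (x == z22).
    - exists 2, 2, [:: 0; 0; 3]; split=> // x.
      by rewrite /good_set -?h0 -?h1 -?h2 -?h3 -?h11 -?h22 -?h111 -?h222 !inE; case: (x == z1);
        case: (x == z11); case: (x == z3); case: (x == z22); case: (x == z222).
  exact: good_set_basis g ht (perm_set _ _ BS e).
- apply: (@good_set_basis _ 0 i [:: 1; 1; 1]) => //; first by rewrite /even_good /= oi !orbT.
  apply: perm_set BS _ => x.
  by rewrite m_mu_ii2 /good_set -?h0 -?h1 -?h2 -?h3 -?h11 -?h22 -?h111 -?h222 !inE; case: (x ==
    z0); case: (x == z1); case: (x == z11); case: (x == z111); case: (x == tripZ [:: i; i; 2]).
- apply: (@good_set_basis _ 0 i [:: 0; 0; 3]) => //; first by rewrite /even_good /= oi !orbT.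
  apply: perm_set BS _ => x.
  by rewrite m_mu_ii2 /good_set -?h0 -?h1 -?h2 -?h3 -?h11 -?h22 -?h111 -?h222 !inE; case: (x ==
    z0); case: (x == z1); case: (x == z11); case: (x == z3); case: (x == tripZ [:: i; i; 2]).
Qed.
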